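(* Let $G=(V,E)$ be a graph on $n$ vertices such that it is possible to remove at most $\epsilon n$ vertices of $G$ and obtain a graph in which every connected component has at most $\epsilon n$ vertices. Then, even knowing that $V=T\cup B$ with $T\cap B=\emptyset$ and $|T|\ge(1-2\epsilon)n$, there is no deterministic algorithm that identifies even a single member $t\in T$ from the reports of all vertices. In particular, the conclusion that no deterministic algorithm can identify even a single member $t\in T$ from the reports of all vertices, even knowing that $|T|\ge(1-2\epsilon)n$, holds for planar graphs, and for graphs with a fixed excluded minor, even with $\epsilon=\Theta(n^{-1/3})$.
   Context: Corruption detection model (PMC model) on an undirected graph $G=(V,E)$ with $n$ vertices (equivalently a symmetric directed graph): each vertex is either truthful (set $T$) or corrupt (set $B$), with $V=T\cup B$, $T\cap B=\emptyset$. Each vertex reports the type (truthful or corrupt) of each of its neighbors. A truthful vertex reports the true type; a corrupt vertex reports adversarially (arbitrarily), and corrupt vertices may coordinate their reports arbitrarily. An algorithm receives all reports and must output conclusions that are correct with certainty. *)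

(* Defs.v *)
From mathcomp Require Import all_boot all_order all_algebra.
From mathcomp Require Import all_classical all_reals all_analysis.

Set Implicit Arguments.
Unset Strict Implicit.
Unset Printing Implicit Defensive.

Import Order.TTheory GRing.Theory Num.Theory.
Import numFieldNormedType.Exports.

Local Open Scope ring_scope.

Record sgraph := SGraph {
  vertex :> finType;
  adj : rel vertex;
  adj_sym : symmetric adj;
  adj_irrefl : irreflexive adj }.

Arguments adj {s}.

Section Induced.
Variables (G : sgraph) (A : {set G}).

Definition induced_adj : rel {v : G | v \in A} :=
  fun u v => adj (val u) (val v).

Fact induced_adj_sym : symmetric induced_adj.
Proof. by move=> u v; exact: adj_sym. Qed.

Fact induced_adj_irrefl : irreflexive induced_adj.
Proof. by move=> u; exact: adj_irrefl. Qed.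

Definition induced_subgraph : sgraph := SGraph induced_adj_sym induced_adj_irrefl.
End Induced.

Definition component (G : sgraph) (v : G) : {set G} := [set u | connect adj v u].

Definition connected_graph (G : sgraph) : Prop :=
  (0 < #|G|)%N /\ forall u v : G, connect adj u v.

Definition remove (G : sgraph) (S : {set G}) : sgraph := induced_subgraph (~: S).

(** One bit per ordered pair of adjacent vertices: [r (u, v)] is the report of
    [u] about its neighbour [v], [true] standing for "truthful". *)
Definition reports (G : sgraph) : finType :=
  {ffun {e : G * G | adj e.1 e.2} -> bool}.

Definition compatible (G : sgraph) (T : {set G}) (r : reports G) : Prop :=
  forall e : {e : G * G | adj e.1 e.2},
    (val e).1 \in T -> r e = ((val e).2 \in T).

(** The space of reports is finite, so a deterministic algorithm is exactly a
    function of the reports. [None] is the answer "no vertex identified". *)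
Definition identifies_truthful (R : realType) (G : sgraph) (eps : R)
    (alg : reports G -> option G) : Prop :=
  forall T B : {set G},
    T :|: B = [set: G] -> [disjoint T & B] ->
    (1 - 2 * eps) * #|G|%:R <= #|T|%:R ->
    forall r : reports G, compatible T r ->
    exists2 t, alg r = Some t & t \in T.

Definition no_algorithm (R : realType) (G : sgraph) (eps : R) : Prop :=
  ~ exists alg : reports G -> option G, identifies_truthful eps alg.

Definition fragmentable (R : realType) (G : sgraph) (eps : R) : Prop :=
  exists S : {set G},
    #|S|%:R <= eps * #|G|%:R /\
    forall v : remove S, #|component v|%:R <= eps * #|G|%:R.

(** [phi] lists the branch sets of a model of [H] in [G]. *)
Definition minor (H G : sgraph) : Prop :=
  exists phi : H -> {set G},
    [/\ forall x, connected_graph (induced_subgraph (phi x)),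
        forall x y, x != y -> [disjoint phi x & phi y] &
        forall x y, adj x y ->
          exists u v, [/\ u \in phi x, v \in phi y & adj u v]].

Local Open Scope classical_set_scope.

Definition is_arc (R : realType) (a b : R * R) (C : set (R * R)) : Prop :=
  exists gamma : R -> R * R,
    [/\ {within `[0, 1], continuous gamma},
        {in `[0, 1] &, injective gamma},
        gamma 0 = a, gamma 1 = b & C = gamma @` `[0, 1]].

Local Close Scope classical_set_scope.

(** A drawing in the plane without crossings: [p] places the vertices and
    [arc [set u; v]] is the curve drawn for the edge [uv]. *)
Definition planar (R : realType) (G : sgraph) : Prop :=
  exists (p : G -> R * R) (arc : {set G} -> set (R * R)),
    [/\ injective p,
        forall u v, adj u v -> is_arc (p u) (p v) (arc [set u; v]),
        forall u v w, adj u v -> arc [set u; v] (p w) -> w = u \/ w = v &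
        forall u v x y, adj u v -> adj x y ->
          [set u; v] <> [set x; y] ->
          forall z, arc [set u; v] z -> arc [set x; y] z ->
          exists2 w, z = p w & w \in [set u; v] :&: [set x; y]].

(* Main.v *)
(** The reports "[v] is corrupt iff [v] is in [S]" are compatible with the corrupt
    set [S] and with [S] joined to any one component of [G - S], so no vertex is
    truthful in all cases.

    For a graph without a clique minor of order [h], the argument of Alon, Seymour
    and Thomas gives a separator of size O(sqrt n) that at least halves all
    components. Halving repeatedly until the components have size [a ^ 2] costs
    O(n / a) vertices, a geometric sum; [a] is taken near the cube root of [n].

    Planar graphs have no [K5] minor: a model of [K5] in a plane graph yields ten
    curves, those of disjoint edges being disjoint. Approximate them by polygonal
    walks in general position. Modulo 2, the number of crossings between walks of
    disjoint edges does not change when all walks are straightened, and it is odd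
    for straight segments, because four points [a b c d] span
    [1 + ccw a b c + ccw a b d + ccw a c d + ccw b c d] crossings and every triple
    lies in two of the five quadruples. *)

Require Import Defs.
From mathcomp Require Import all_boot zify.

Set Implicit Arguments.
Unset Strict Implicit.
Unset Printing Implicit Defensive.

(** * Separators of graphs without a clique minor *)

(** As long as the second coordinate stays below [h], [a * h + c] orders pairs lexicographically: a
    drop in [a] outweighs any growth of [c]. *)
Lemma ltn_lex_measure a b c d h m :
  a < b -> c < h -> b * h + d < m.+1 -> a * h + c < m.
Proof. move=> ab ch hm; have := leq_mul ab (leqnn h); lia. Qed.

(** * Connected vertex sets and components of a finite graph *)

Section Connected.
Variables (V : finType) (e : rel V).
Hypothesis e_sym : symmetric e.
Implicit Types (A B K S T U W X Z : {set V}) (C : {set {set V}}).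

(** Induced subgraphs stay relations on the ambient type, so that vertex sets of different ones can
    be compared directly. *)
Definition restr A : rel V := fun x y => [&& x \in A, y \in A & e x y].

Definition conn A :=
  (A != set0) && [forall x in A, forall y in A, connect (restr A) x y].

Definition comp_in A x := [set y in A | connect (restr A) x y].

Definition nbhd U W := [set v in U :\: W | [exists w in W, e w v]].

Definition touch A B := [exists x in A, exists y in B, e x y].

Lemma nbhdE U W v :
  (v \in nbhd U W) = (v \notin W) && (v \in U) && [exists w in W, e w v].
Proof. by rewrite !inE. Qed.

Lemma connP A :
  reflect ((exists x, x \in A) /\ {in A &, forall x y, connect (restr A) x y})
          (conn A).
Proof.
apply: (iffP andP) => [[/set0Pn h1 /forall_inP h2]|[h1 h2]]; split=> //.
- by move=> x y xA yA; apply: (forall_inP (h2 x xA)).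
- exact/set0Pn.
- by apply/forall_inP=> x xA; apply/forall_inP=> y yA; apply: h2.
Qed.

Lemma touchP A B :
  reflect (exists x y, [/\ x \in A, y \in B & e x y]) (touch A B).
Proof.
apply: (iffP exists_inP) => [[x xA /exists_inP[y yB exy]]|[x [y [xA yB exy]]]].
  by exists x, y.
by exists x => //; apply/exists_inP; exists y.
Qed.

Lemma touch_sym A B : touch A B = touch B A.
Proof.
by apply/touchP/touchP=> -[x [y [h1 h2 h3]]]; exists y, x; rewrite e_sym.
Qed.

Lemma restr_sym A : connect_sym (restr A).
Proof. by apply: sym_connect_sym => x y; rewrite /restr e_sym andbCA. Qed.

Lemma connect_restrS A B x y :
  A \subset B -> connect (restr A) x y -> connect (restr B) x y.
Proof.
move=> sAB; apply: connect_sub => a b /and3P[aA bA eab]; apply: connect1.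
by rewrite /restr (subsetP sAB _ aA) (subsetP sAB _ bA).
Qed.

Lemma connect_closed A (P : pred V) x y :
  (forall a b, a \in A -> b \in A -> e a b -> P a -> P b) ->
  connect (restr A) x y -> P x -> P y.
Proof.
move=> clP /connectP[p + ->]; elim: p x => //= a p IH x /andP[/and3P[xA aA exa]].
by move=> pa Px; apply: IH pa _; apply: clP exa Px.
Qed.

Lemma conn_propagate K (P : {set V}) x :
  conn K -> x \in K -> x \in P ->
  (forall a b, a \in K -> b \in K -> e a b -> a \in P -> b \in P) ->
  K \subset P.
Proof.
move=> /connP[_ cK] xK xP clP; apply/subsetP=> y yK.
exact: (connect_closed (P := mem P) clP (cK _ _ xK yK)).
Qed.

Lemma conn1 x : conn [set x].
Proof.
apply/connP; split; first by exists x; rewrite inE.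
by move=> a b /set1P-> /set1P->.
Qed.

Lemma conn_add T v w : conn T -> v \in T -> e v w -> conn (w |: T).
Proof.
move=> /connP[_ cT] vT evw.
have h a : a \in w |: T -> connect (restr (w |: T)) v a.
  case/setU1P=> [->|aT]; last exact: connect_restrS (subsetUr _ _) (cT _ _ vT aT).
  by apply: connect1; rewrite /restr !inE eqxx vT evw orbT.
apply/connP; split; first by exists w; rewrite !inE eqxx.
move=> a b /h ha /h hb; apply: connect_trans hb.
by rewrite restr_sym.
Qed.

Lemma mem_comp_in A x : x \in A -> x \in comp_in A x.
Proof. by move=> xA; rewrite inE xA connect0. Qed.

Lemma comp_in_sub A x : comp_in A x \subset A.
Proof. by apply/subsetP=> y; rewrite inE => /andP[]. Qed.

Lemma comp_in_closed A x a b :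
  a \in comp_in A x -> b \in A -> e a b -> b \in comp_in A x.
Proof.
rewrite !inE => /andP[aA xa] bA eab; rewrite bA.
by apply: connect_trans xa (connect1 _); rewrite /restr aA bA.
Qed.

Lemma comp_in_conn A x : x \in A -> conn (comp_in A x).
Proof.
move=> xA; have h y : y \in comp_in A x -> connect (restr (comp_in A x)) x y.
  rewrite inE => /andP[_ xy].
  (* Membership in the component and connection inside it travel along the path together: each step
     of the second needs the first. *)
  have /andP[] // : (y \in comp_in A x) && connect (restr (comp_in A x)) x y.
  apply: (connect_closed (A := A)
    (P := fun y => (y \in comp_in A x) && connect (restr (comp_in A x)) x y) _ xy).
    move=> a b aA bA eab /andP[ac xa].
    have bc := comp_in_closed ac bA eab; rewrite bc.
    by apply: connect_trans xa (connect1 _); rewrite /restr ac bc.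
  by rewrite mem_comp_in // connect0.
apply/connP; split; first by exists x; apply: mem_comp_in.
by move=> a b /h ha /h hb; apply: connect_trans hb; rewrite restr_sym.
Qed.

Lemma conn_sub_comp_in A K x : conn K -> K \subset A -> x \in K -> K \subset comp_in A x.
Proof.
move=> cK sKA xK; apply: (conn_propagate cK xK).
  by apply: mem_comp_in; apply: (subsetP sKA).
by move=> a b aK bK eab ac; apply: comp_in_closed ac _ eab; apply: (subsetP sKA).
Qed.

(* [reach t i] is the set of vertices lying in a connected set of size at most
   [t] that meets the first [i] of the sets [A j]; the layers
   [reach t.+1 i :\: reach t i] separate once the last set is not reached. *)
Lemma hitting_set_or_separator W (k : nat) (A : nat -> {set V}) (s : nat) :
  0 < s ->
  (exists T, [/\ conn T, T \subset W, #|T| <= s &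
                 forall j, j < k -> ~~ [disjoint T & A j]]) \/
  (exists Z, [/\ Z \subset W, #|Z| * s <= k * #|W| &
     forall K, conn K -> K \subset W :\: Z ->
       exists2 j, j < k & [disjoint K & A j]]).
Proof.
move=> s_gt0.
pose good t i (T : {set V}) := [&& conn T, T \subset W, #|T| <= t &
  [forall j : 'I_k, (j < i) ==> ~~ [disjoint T & A j]]].
pose reach t i := [set v | [exists T : {set V}, good t i T && (v \in T)]].
have reachP t i v : reflect (exists2 T, good t i T & v \in T) (v \in reach t i).
  rewrite inE; apply: (iffP existsP) => [[T /andP[]]|[T gT vT]]; exists T => //.
  by rewrite gT.
have reachW t i : reach t i \subset W.
  apply/subsetP=> v /reachP[T /and4P[_ sTW _ _]]; exact: subsetP.
have reach_step t i v w :
    v \in reach t i -> w \in W -> e v w -> w \in reach t.+1 i.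
  move=> /reachP[T /and4P[cT sTW szT hT] vT] wW evw; apply/reachP.
  exists (w |: T); last by rewrite !inE eqxx.
  apply/and4P; split; first exact: conn_add vT evw.
  - by rewrite subUset sub1set wW.
  - by rewrite cardsU1; case: (_ \notin _) => //=; lia.
  - apply/forallP=> j; apply/implyP=> ji; have /forallP/(_ j) := hT.
    rewrite ji /=; apply: contra; apply: disjointWl; exact: subsetUr.
have reach_next t i v :
    v \in reach t i -> v \in A i -> v \in reach t i.+1.
  move=> /reachP[T /and4P[cT sTW szT hT] vT] vA; apply/reachP; exists T => //.
  apply/and4P; split=> //; apply/forallP=> j; apply/implyP; rewrite ltnS leq_eqVlt.
  case/orP=> [/eqP->|ji]; last by have /forallP/(_ j) := hT; rewrite ji.
  by apply/negP=> /pred0P/(_ v) /=; rewrite vT vA.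
have reach_mono t i : reach t i \subset reach t.+1 i.
  apply/subsetP=> v /reachP[T /and4P[cT sTW szT hT] vT]; apply/reachP; exists T => //.
  by apply/and4P; split=> //; lia.
pose Z t := \bigcup_(i < k) (reach t.+1 i :\: reach t i).
(* For each [i] the layer sizes telescope to at most [#|W|], so one of the [s] sets is no larger
   than the average. Sizes start at 1 so that singletons put all of [W] into [reach t.+1 0]. *)
case: (boolP [exists t : 'I_s, #|Z t.+1| * s <= k * #|W|]); last first.
  rewrite negb_exists => /forallP bad; exfalso.
  have h m : \sum_(t < m) #|Z t.+1| <= \sum_(i < k) #|reach m.+1 i|.
    elim: m => [|m IH]; first by rewrite big_ord0.
    rewrite big_ord_recr /=; apply: leq_trans (leq_add IH (leqnn _)) _.
    have hZ : #|Z m.+1| <= \sum_(i < k) #|reach m.+2 i :\: reach m.+1 i|.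
      rewrite /Z; elim/big_rec2: _ => [|i x y _ IH']; first by rewrite cards0.
      by apply: leq_trans (leq_card_setU _ _) _; rewrite leq_add2l.
    apply: leq_trans (leq_add (leqnn _) hZ) _; rewrite -big_split /=.
    apply: leq_sum => i _; rewrite cardsD.
    have /setIidPr -> := reach_mono m.+1 i.
    by rewrite subnKC // subset_leq_card.
  have h1 : \sum_(t < s) #|Z t.+1| <= k * #|W|.
    apply: leq_trans (h s) _; rewrite -[k in k * _]card_ord -sum_nat_const.
    by apply: leq_sum => i _; apply: subset_leq_card.
  have : \sum_(t < s) (k * #|W|).+1 <= \sum_(t < s) #|Z t.+1| * s.
    by apply: leq_sum => t _; have := bad t; rewrite -ltnNge.
  rewrite sum_nat_const card_ord -big_distrl /= mulnC leq_pmul2r // => h2.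
  by have := leq_trans h2 h1; rewrite ltnn.
case/existsP=> t hZ.
case: (boolP [exists T : {set V}, good s k T]) => [/existsP[T /and4P[cT sTW szT hT]]|].
  left; exists T; split=> // j jk.
  by have /forallP/(_ (Ordinal jk)) := hT; rewrite /= jk.
rewrite negb_exists => /forallP nogood; right; exists (Z t.+1); split=> //.
  apply/bigcupsP=> i _; apply: subset_trans (subsetDl _ _) (reachW _ _).
move=> K cK sKW.
case: (boolP [exists j : 'I_k, [disjoint K & A j]]) => [/existsP[j hj]|].
  by exists j.
rewrite negb_exists => /forallP hK; exfalso.
have [[x xK] _] := connP _ cK.
have sKW' : K \subset W by apply: subset_trans sKW (subsetDl _ _).
have h0 : K \subset reach t.+1 0.
  apply/subsetP=> v vK; apply/reachP; exists [set v]; last by rewrite inE.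
  apply/and4P; split; [exact: conn1| |by rewrite cards1|by apply/forallP].
  by rewrite sub1set (subsetP sKW').
(* As [K] avoids [Z t.+1], one vertex of [K] in [reach t.+1 i] brings along all of [K], and a vertex
   of [K] in [A i] then climbs to the next level. Level [k] contradicts [nogood]. *)
have hi i : i <= k -> exists2 v, v \in K & v \in reach t.+1 i.
  elim: i => [_|i IH ik]; first by exists x => //; apply: (subsetP h0).
  have [v vK vr] := IH (ltnW ik).
  have sKr : K \subset reach t.+1 i.
    apply: (conn_propagate cK vK vr) => a b aK bK eab ar.
    have bW := subsetP sKW' _ bK.
    have br := reach_step _ _ _ _ ar bW eab.
    have := subsetP sKW _ bK; rewrite inE => /andP[bZ _].
    apply: contraNT bZ => bnr; apply/bigcupP; exists (Ordinal ik) => //.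
    by rewrite inE bnr.
  have /pred0Pn[w /= /andP[wK wA]] := hK (Ordinal ik).
  by exists w => //; apply: reach_next => //; apply: (subsetP sKr).
have [v _ /reachP[T /and4P[cT sTW szT hT] _]] := hi k (leqnn k).
have /negP[] := nogood T; apply/and4P; split=> //.
by apply: leq_trans szT _.
Qed.

(** * Models of complete graphs and balanced separators *)

Definition clique_model C :=
  {in C, forall A, conn A} /\
  {in C &, forall A B, A != B -> [disjoint A & B] && touch A B}.

Lemma meet_not_disjoint A B x : x \in A -> x \in B -> [disjoint A & B] = false.
Proof. by move=> xA xB; apply/negP=> /pred0P/(_ x) /=; rewrite xA xB. Qed.

Lemma component_around U X K :
  conn K -> K \subset U :\: X ->
  exists W, [/\ conn W, K \subset W, W \subset U :\: X & nbhd U W \subset X].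
Proof.
move=> cK sK; have [[x xK] _] := connP _ cK; exists (comp_in (U :\: X) x); split.
- by apply: comp_in_conn; apply: (subsetP sK).
- exact: conn_sub_comp_in.
- exact: comp_in_sub.
apply/subsetP=> v; rewrite !inE => /andP[/andP[vc vU] /exists_inP[w wc ewv]].
apply: contraNT vc => vX; have := comp_in_closed wc _ ewv; rewrite !inE; apply.
by rewrite vX vU.
Qed.

Lemma majority_meet U A B :
  A \subset U -> B \subset U -> #|U| < 2 * #|A| -> #|U| < 2 * #|B| ->
  exists2 x, x \in A & x \in B.
Proof.
move=> sA sB hA hB; have : A :&: B != set0.
  apply/eqP=> AB0; have := cardsUI A B; rewrite AB0 cards0.
  have : #|A :|: B| <= #|U| by apply: subset_leq_card; rewrite subUset sA.
  lia.
by case/set0Pn=> x; rewrite inE => /andP[]; exists x.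
Qed.

(* The separator theorem of Alon, Seymour and Thomas. Without such a [Z], every
   set of at most [h * s] vertices leaves a unique majority component. We keep a
   clique model [C] and a majority component [W] whose neighbourhood is covered
   by [C], with at most [s] vertices in each member. As long as [C] has fewer
   than [h] members, either [C] grows or [W] shrinks. *)
Theorem clique_free_separator U (h s : nat) :
  h * #|U| <= s * s ->
  (forall C, {in C, forall A, A \subset U} -> clique_model C -> #|C| != h) ->
  exists Z, [/\ Z \subset U, #|Z| <= h * s &
    forall K, conn K -> K \subset U :\: Z -> 2 * #|K| <= #|U|].
Proof.
move=> hs nocl.
case: (set_0Vmem U) => [U0|[u0 u0U]].
  exists set0; rewrite sub0set cards0; split=> // K /connP[[x xK] _] /subsetP/(_ x xK).
  by rewrite U0 !inE.
have U_gt0 : 0 < #|U| by apply/card_gt0P; exists u0.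
have h_gt0 : 0 < h.
  rewrite lt0n; apply/eqP=> h0.
  have := nocl set0; rewrite cards0 h0 eqxx => H.
  suff: false by [].
  apply: H; first by move=> A; rewrite inE.
  by split=> A; rewrite inE.
have s_gt0 : 0 < s.
  have : 0 < s * s by apply: leq_trans hs; rewrite muln_gt0 h_gt0.
  by rewrite muln_gt0 => /andP[].
pose sep Z := [&& Z \subset U, #|Z| <= h * s & [forall K : {set V},
  conn K ==> (K \subset U :\: Z) ==> (2 * #|K| <= #|U|)]].
case: (boolP [exists Z, sep Z]) => [/existsP[Z /and3P[h1 h2 h3]]|].
  exists Z; split=> // K cK sK; move/forallP/(_ K): h3; by rewrite cK sK.
rewrite negb_exists => /forallP nosep; exfalso.
have bigc X : X \subset U -> #|X| <= h * s ->
    exists W, [/\ conn W, W \subset U :\: X, #|U| < 2 * #|W| & nbhd U W \subset X].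
  move=> sXU szX; have := nosep X; rewrite /sep sXU szX /= negb_forall.
  case/existsP=> K; rewrite !negb_imply => /and3P[cK sK]; rewrite -ltnNge => bK.
  have [W [cW sKW sW nW]] := component_around cK sK; exists W; split=> //.
  have := subset_leq_card sKW; lia.
(* Each round either keeps [W] and drops a member of [C], or shrinks [W] strictly while [C] stays
   below [h] members. *)
have key m C W : #|W| * h + #|C| < m -> #|C| < h ->
  {in C, forall A, A \subset U} -> clique_model C ->
  conn W -> W \subset U -> #|U| < 2 * #|W| ->
  {in C, forall A, [disjoint A & W]} -> nbhd U W \subset cover C ->
  {in C, forall A, #|nbhd U W :&: A| <= s} -> False.
  elim: m C W => [//|m IH] C W hm Ch CU CC cW sWU bW dCW nWC nWs.
  case: (boolP [exists A in C, ~~ touch A W]) => [/exists_inP[A AC nAW]|].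
    (* A set without neighbours in [W] can be dropped. *)
    have hC : #|C| = #|C :\ A|.+1 by rewrite (cardsD1 A) AC.
    have nA x : x \in nbhd U W -> x \notin A.
      rewrite !inE => /andP[_ /exists_inP[w wW ewx]]; apply: contra nAW => xA.
      by apply/touchP; exists x, w; rewrite e_sym.
    apply: (IH (C :\ A) W) => //; first by rewrite hC addnS in hm.
    - by rewrite hC in Ch; apply: ltnW.
    - by move=> B /setD1P[_]; apply: CU.
    - case: CC => CC1 CC2; split; first by move=> B /setD1P[_]; apply: CC1.
      by move=> B D /setD1P[_ BC] /setD1P[_ DC]; apply: CC2.
    - by move=> B /setD1P[_]; apply: dCW.
    - apply/subsetP=> x xN; have /bigcupP[B BC xB] := subsetP nWC _ xN.
      apply/bigcupP; exists B => //; apply/setD1P; split=> //.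
      by apply: contraNneq (nA _ xN) => <-.
    - by move=> B /setD1P[_]; apply: nWs.
  rewrite negb_exists_in => /forall_inP tCW.
  have {}tCW A : A \in C -> touch A W by move=> /tCW; rewrite negbK.
  have hnW : #|nbhd U W| <= #|C| * s.
    have -> : nbhd U W = \bigcup_(A in C) (nbhd U W :&: A).
      apply/setP=> x; apply/idP/bigcupP => [xN|[A _ /setIP[]//]].
      have /bigcupP[B BC xB] := subsetP nWC _ xN; exists B => //.
      by rewrite inE xN.
    rewrite -sum_nat_const; apply: leq_trans (_ : \sum_(A in C) #|nbhd U W :&: A| <= _).
      elim/big_rec2: _ => [|i x y _ IH']; first by rewrite cards0.
      by apply: leq_trans (leq_card_setU _ _) _; rewrite leq_add2l.
    by apply: leq_sum => A AC; apply: nWs.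
  pose att A := [set w in W | [exists a in A, e a w]].
  (* A majority component meets the majority [W] and cannot leave it without passing through
     [nbhd U W]. *)
  have inW W' X : conn W' -> W' \subset U :\: (nbhd U W :|: X) ->
      #|U| < 2 * #|W'| -> W' \subset W :\: X.
    move=> cW' sW' bW'.
    have sW'U : W' \subset U by apply: subset_trans sW' (subsetDl _ _).
    have [x xW xW'] := majority_meet sWU sW'U bW bW'.
    have sW'W : W' \subset W.
      apply: (conn_propagate cW' xW' xW) => a b aW' bW1 eab aW.
      apply: contraT => bW0; have := subsetP sW' _ bW1; rewrite !inE.
      rewrite bW0 (subsetP sW'U _ bW1) /=.
      by have -> : [exists w in W, e w b] by apply/exists_inP; exists a.
    apply/subsetP=> y yW'; rewrite inE (subsetP sW'W _ yW') andbT.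
    by have := subsetP sW' _ yW'; rewrite !inE negb_or -andbA => /and3P[].
  have hX X : X \subset W -> #|X| <= s ->
      exists W', [/\ conn W', W' \subset W :\: X, #|U| < 2 * #|W'| &
                     nbhd U W' \subset nbhd U W :|: X].
    move=> sXW szX.
    have [||W' [cW' sW' bW' nW']] := bigc (nbhd U W :|: X).
    - rewrite subUset (subset_trans sXW sWU) andbT; apply/subsetP=> x.
      by rewrite !inE -andbA => /and3P[].
    (* The slack [#|C| < h] is spent here: [nbhd U W] takes at most [#|C| * s] vertices and [X]
       another [s]. *)
    - apply: leq_trans (leq_card_setU _ _) (leq_trans (leq_add hnW szX) _).
      by rewrite addnC -mulSn leq_mul2r Ch orbT.
    exists W'; split=> //; exact: inW.
  (* The sets to hit are the attachments in [W] of the members of [C]. A hitting set [T] touches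
     every member and joins the model; otherwise removing [Z] cuts the next majority component off
     from the attachments of some member [A]. *)
  have [[T [cT sTW szT hT]]|[Z [sZW szZ hZ]]] :=
    hitting_set_or_separator W #|C| (fun j => att (nth set0 (enum C) j)) s_gt0.
    have tT A : A \in C -> touch A T.
      move=> AC; have AE : A \in enum C by rewrite mem_enum.
      have := hT (index A (enum C)); rewrite nth_index // cardE index_mem => /(_ AE).
      case/pred0Pn=> w /= /andP[wT]; rewrite inE => /andP[_ /exists_inP[a aA eaw]].
      by apply/touchP; exists a, w.
    have dT A : A \in C -> [disjoint A & T].
      by move=> /dCW; apply: disjointWr.
    have [[t0 t0T] _] := connP _ cT.
    have TC : T \notin C.
      by apply/negP=> /dT; rewrite (meet_not_disjoint t0T t0T).
    have CU' : {in T |: C, forall A, A \subset U}.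
      by move=> A /setU1P[->|/CU//]; apply: subset_trans sWU.
    have CC' : clique_model (T |: C).
      case: CC => CC1 CC2; split=> [A /setU1P[->//|/CC1//]|].
      move=> A B /setU1P[->|AC] /setU1P[->|BC]; rewrite ?eqxx // => AB.
      - by rewrite disjoint_sym touch_sym dT // tT.
      - by rewrite dT // tT.
      - exact: CC2.
    have hTC : #|T |: C| = #|C|.+1 by rewrite cardsU1 TC.
    have Ch' : #|C|.+1 < h.
      by rewrite ltn_neqAle Ch andbT -hTC; apply: nocl.
    have [W' [cW' sW' bW' nW']] := hX T sTW szT.
    have ltW : #|W'| < #|W|.
      apply: leq_ltn_trans (subset_leq_card sW') _; apply: proper_card.
      rewrite properE subsetDl; apply/subsetPn; exists t0.
        by apply: (subsetP sTW).
      by rewrite inE t0T.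
    have sW'W : W' \subset W by apply: subset_trans sW' (subsetDl _ _).
    apply: (IH (T |: C) W') => //.
    - by rewrite hTC; apply: ltn_lex_measure ltW Ch' hm.
    - by rewrite hTC.
    - exact: subset_trans sWU.
    - move=> A /setU1P[->|/dCW]; last exact: disjointWr.
      rewrite disjoint_sym; apply/pred0P=> x /=; apply/negP=> /andP[xW' xT].
      by have := subsetP sW' _ xW'; rewrite inE xT.
    - apply/subsetP=> x /(subsetP nW') /setUP[xN|xT].
        have /bigcupP[B BC xB] := subsetP nWC _ xN.
        by apply/bigcupP; exists B => //; rewrite inE BC orbT.
      by apply/bigcupP; exists T => //; rewrite !inE eqxx.
    - move=> A /setU1P[->|AC].
        by apply: leq_trans szT; apply: subset_leq_card; apply: subsetIr.
      apply: leq_trans (nWs _ AC); apply: subset_leq_card; apply/subsetP=> x.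
      move=> /setIP[/(subsetP nW') /setUP[xN|xT] xA]; first by rewrite inE xN.
      by have := dT _ AC; rewrite (meet_not_disjoint xA xT).
  (* [#|Z| * s <= #|C| * #|W| <= h * #|U| <= s * s]. *)
  have szZ' : #|Z| <= s.
    rewrite -(leq_pmul2r s_gt0); apply: leq_trans szZ (leq_trans _ hs).
    by apply: leq_mul; [exact: ltnW|exact: subset_leq_card].
  have [W' [cW' sW' bW' nW']] := hX Z sZW szZ'.
  have [j jC dj] := hZ W' cW' sW'.
  set A := nth set0 (enum C) j in dj.
  have AC : A \in C by rewrite -mem_enum mem_nth // -cardE.
  have cA : conn A by case: CC => + _; apply.
  have [[a0 a0A] cA'] := connP _ cA.
  have sW'W : W' \subset W by apply: subset_trans sW' (subsetDl _ _).
  (* [Q] absorbs into [A] whatever of [W :\: W'] hangs on it; the rest of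
     [W :\: W'] goes back to [W']. *)
  pose Q := comp_in (A :|: (W :\: W')) a0.
  have a0Q : a0 \in A :|: (W :\: W') by rewrite inE a0A.
  have cQ : conn Q by apply: comp_in_conn.
  have sAQ : A \subset Q by apply: conn_sub_comp_in => //; apply: subsetUl.
  have QW' x : x \in W' -> x \notin Q.
    move=> xW'; apply/negP=> /(subsetP (comp_in_sub _ _)); rewrite !inE xW' /= orbF.
    move=> xA; have := dCW _ AC; rewrite (meet_not_disjoint xA) //.
    exact: (subsetP sW'W).
  have attQ x : x \in att A -> x \in Q.
    rewrite inE => /andP[xW /exists_inP[a aA eax]].
    apply: (comp_in_closed (subsetP sAQ _ aA) _ eax); rewrite !inE xW andbT.
    rewrite (_ : x \notin W') ?orbT //; apply/negP=> xW'.
    have := dj; rewrite (@meet_not_disjoint _ _ x) // inE xW /=.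
    by apply/exists_inP; exists a.
  have QWA x : x \in Q -> (x \in A) || (x \in W).
    by move=> /(subsetP (comp_in_sub _ _)); rewrite !inE => /orP[->|/andP[_ ->]] //; rewrite orbT.
  have [[x0 x0W'] _] := connP _ cW'.
  pose W2 := comp_in (W :\: Q) x0.
  have sW'2 : W' \subset W :\: Q.
    by apply/subsetP=> x xW'; rewrite inE QW' // (subsetP sW'W).
  have x0WQ := subsetP sW'2 _ x0W'.
  have cW2 : conn W2 by apply: comp_in_conn.
  have sW'W2 : W' \subset W2 by apply: conn_sub_comp_in.
  have sW2 : W2 \subset W :\: Q by apply: comp_in_sub.
  have sW2W : W2 \subset W by apply: subset_trans sW2 (subsetDl _ _).
  have nW2 x : x \in nbhd U W2 -> (x \in nbhd U W) || (x \in Q).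
    rewrite !nbhdE => /andP[/andP[xW2 xU] /exists_inP[w wW2 ewx]].
    case: (boolP (x \in Q)) => xQ; rewrite ?orbT // orbF.
    have xW : x \notin W.
      apply: contra xW2 => xW; have := comp_in_closed wW2 _ ewx.
      by rewrite in_setD; apply; rewrite xQ xW.
    rewrite xW xU; apply/exists_inP; exists w => //; exact: (subsetP sW2W).
  (* Let [w] in [W2] be adjacent to [x] in [Q]. If [x] were in [A], then [w] would be attached to
     [A] and lie in [Q]; so [x] is in [W]. If [w] were outside [W'], it would be absorbed into [Q].
     Hence [x] is a neighbour of [W'] inside [W], which leaves only [Z]. *)
  have nW2Q x : x \in nbhd U W2 -> x \in Q -> x \in Z.
    rewrite !nbhdE => /andP[/andP[xW2 xU] /exists_inP[w wW2 ewx]] xQ.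
    have wWQ := subsetP sW2 _ wW2.
    have /setDP[wW wQ] := wWQ.
    have xA : x \notin A.
      apply: contra wQ => xA; apply: attQ; rewrite inE wW; apply/exists_inP.
      by exists x; rewrite // e_sym.
    have xW : x \in W by have := QWA _ xQ; rewrite (negPf xA).
    have wW' : w \in W'.
      apply: contraT => wW'; case/negP: wQ.
      apply: comp_in_closed xQ _ _; last by rewrite e_sym; exact: ewx.
      by rewrite !inE wW wW' orbT.
    have : x \in nbhd U W'.
      rewrite nbhdE xU andbT; apply/andP; split; last by apply/exists_inP; exists w.
      by apply/negP=> /QW'; rewrite xQ.
    move=> /(subsetP nW') /setUP[|//]; by rewrite nbhdE xW.
  have dQ B : B \in C -> B != A -> [disjoint B & Q].
    move=> BC BA; have [_ /(_ _ _ BC AC BA) /andP[dBA _]] := CC.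
    apply/pred0P=> x /=; apply/negP=> /andP[xB /QWA /orP[xA|xW]].
      by rewrite (meet_not_disjoint xB xA) in dBA.
    by have := dCW _ BC; rewrite (meet_not_disjoint xB xW).
  have tQ B : B \in C -> B != A -> touch B Q.
    move=> BC BA; have [_ /(_ _ _ BC AC BA) /andP[_ /touchP[x [y [xB yA exy]]]]] := CC.
    by apply/touchP; exists x, y; rewrite (subsetP sAQ).
  have szQ : #|Q |: C :\ A| <= #|C|.
    rewrite cardsU1 [in X in _ <= X](cardsD1 A) AC leq_add2r; exact: leq_b1.
  have ltW : #|W2| < #|W|.
    have /touchP[a [w [aA wW eaw]]] := tCW _ AC.
    apply: leq_ltn_trans (subset_leq_card sW2) _; apply: proper_card.
    rewrite properE subsetDl; apply/subsetPn; exists w => //.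
    rewrite inE attQ // inE wW; by apply/exists_inP; exists a.
  apply: (IH (Q |: C :\ A) W2) => //.
  - exact: ltn_lex_measure ltW (leq_ltn_trans szQ Ch) hm.
  - exact: leq_ltn_trans Ch.
  - move=> B /setU1P[->|/setD1P[_ /CU//]].
    apply/subsetP=> x /QWA /orP[|/(subsetP sWU)//]; exact: (subsetP (CU _ AC)).
  - have [CC1 CC2] := CC; split=> [B /setU1P[->//|/setD1P[_ /CC1//]]|].
    move=> B D /setU1P[->|/setD1P[BA BC]] /setU1P[->|/setD1P[DA DC]]; rewrite ?eqxx // => BD.
    + by rewrite disjoint_sym touch_sym dQ // tQ.
    + by rewrite dQ // tQ.
    + exact: CC2.
  - exact: subset_trans sWU.
  - by apply: leq_trans bW' _; rewrite leq_mul2l subset_leq_card.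
  - move=> B /setU1P[->|/setD1P[_ /dCW]]; last exact: disjointWr.
    rewrite disjoint_sym; apply/pred0P=> x /=; apply/negP=> /andP[/(subsetP sW2)].
    by rewrite inE => /andP[/negP xQ _].
  - apply/subsetP=> x /nW2 /orP[/(subsetP nWC) /bigcupP[B BC xB]|xQ]; last first.
      by apply/bigcupP; exists Q => //; rewrite !inE eqxx.
    have [BA|BA] := eqVneq B A; last first.
      by apply/bigcupP; exists B => //; rewrite !inE BA BC orbT.
    apply/bigcupP; exists Q; first by rewrite !inE eqxx.
    by apply: (subsetP sAQ); rewrite -BA.
  - move=> B /setU1P[->|/setD1P[BA BC]].
      apply: leq_trans szZ'; apply: subset_leq_card; apply/subsetP=> x /setIP[].
      exact: nW2Q.
    apply: leq_trans (nWs _ BC); apply: subset_leq_card; apply/subsetP=> x /setIP[xN xB].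
    rewrite inE xB andbT; have /orP[//|xQ] := nW2 _ xN.
    by have := dQ _ BC BA; rewrite (meet_not_disjoint xB xQ).
have [||W [cW sW bW nW]] := bigc set0; rewrite ?sub0set ?cards0 //.
apply: (key (#|W| * h + 0).+1 set0 W) => //; rewrite ?cards0 //.
- by move=> A; rewrite inE.
- by split=> A; rewrite inE.
- by apply: subset_trans sW (subsetDl _ _).
- by move=> A; rewrite inE.
- by apply: subset_trans nW (sub0set _).
- by move=> A; rewrite inE.
Qed.

(** * Repeated halving of components *)

Definition clique_free h := forall C, clique_model C -> #|C| != h.

Lemma comp_in_meet A x y z : z \in comp_in A x -> z \in comp_in A y -> comp_in A x = comp_in A y.
Proof.
rewrite !inE => /andP[_ xz] /andP[_ yz]; apply/setP=> w; rewrite !inE.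
have xy : connect (restr A) x y by apply: connect_trans xz _; rewrite restr_sym.
by rewrite (same_connect (restr_sym A) xy).
Qed.

(** Only components with more than [c] vertices are separated. They are disjoint, so their number
    [N] satisfies [N * c <= #|V|], and each costs at most [h * s] vertices. *)
Lemma halve_components h b c s S :
  clique_free h -> h * b <= s * s -> b <= 2 * c ->
  (forall K, conn K -> K \subset ~: S -> #|K| <= b) ->
  exists S' N, [/\ #|S'| <= #|S| + N * (h * s), N * c <= #|V| &
    forall K, conn K -> K \subset ~: S' -> #|K| <= c].
Proof.
move=> hfree hs bc Sb.
pose P := [set comp_in (~: S) x | x in ~: S & c < #|comp_in (~: S) x|].
have exZ K : exists Z, K \in P -> #|Z| <= h * s /\
    forall L, conn L -> L \subset K :\: Z -> 2 * #|L| <= #|K|.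
  case: (boolP (K \in P)) => [/imsetP[x]|]; last by exists set0.
  rewrite inE => /andP[xS _] ->.
  have [||Z [_ h1 h2]] := @clique_free_separator (comp_in (~: S) x) h s; last by exists Z.
    apply: leq_trans hs; rewrite leq_mul2l Sb ?orbT ?comp_in_sub //.
    exact: comp_in_conn.
  by move=> C _; apply: hfree.
have [f hf] := fin_all_exists exZ.
have tP : trivIset P.
  apply/trivIsetP=> A B /imsetP[x _ ->] /imsetP[y _ ->].
  apply: contraR => /pred0Pn[z /= /andP[zx zy]]; apply/eqP; exact: comp_in_meet zx zy.
exists (S :|: \bigcup_(K in P) f K), #|P|; split.
- apply: leq_trans (leq_card_setU _ _) _; rewrite leq_add2l -sum_nat_const.
  apply: leq_trans (_ : \sum_(K in P) #|f K| <= _).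
    elim/big_rec2: _ => [|i x y _ IH']; first by rewrite cards0.
    by apply: leq_trans (leq_card_setU _ _) _; rewrite leq_add2l.
  by apply: leq_sum => K KP; have [] := hf K KP.
- rewrite -sum_nat_const; apply: leq_trans (max_card (mem (cover P))).
  have /eqP <- := tP; apply: leq_sum => K /imsetP[x].
  by rewrite inE => /andP[_ /ltnW hx] ->.
move=> K cK sK; have [[x xK] _] := connP _ cK.
have sKS : K \subset ~: S by apply: subset_trans sK _; rewrite setCS subsetUl.
have sKD := conn_sub_comp_in cK sKS xK.
have [/(leq_trans (subset_leq_card sKD))//|cD] := leqP #|comp_in (~: S) x| c.
have xS := subsetP sKS _ xK.
have DP : comp_in (~: S) x \in P by apply/imsetP; exists x => //; rewrite inE xS.
have [_ /(_ K cK) hK] := hf _ DP.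
have Db := Sb _ (comp_in_conn xS) (comp_in_sub _ _).
have : 2 * #|K| <= 2 * c.
  apply: leq_trans (leq_trans Db bc); apply: hK; apply/subsetP=> y yK.
  rewrite inE (subsetP sKD _ yK) andbT; apply/negP=> yf.
  have := subsetP sK _ yK; rewrite !inE negb_or => /andP[_ /negP]; apply.
  by apply/bigcupP; exists (comp_in (~: S) x).
by rewrite leq_pmul2l.
Qed.

(** Two halvings lead from component size [(2 * a) ^ 2] through [2 * a ^ 2] to [a ^ 2]. In units of
    [h ^ 2 * #|V| / a], they cost 1 and 2, and the set obtained for [2 * a] costs 3, whence the
    constant 6. *)
Lemma clique_free_fragmentation h a :
  clique_free h -> 0 < a ->
  exists S, #|S| * a <= 6 * h ^ 2 * #|V| /\
    forall K, conn K -> K \subset ~: S -> #|K| <= a ^ 2.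
Proof.
move=> hfree; have : #|V| <= 4 ^ #|V| by apply: ltnW; apply: ltn_expl.
(* [i] doublings of [a] reach a scale at which the whole graph is already small enough. *)
move: {2}#|V| => i /(leq_trans)/(_ (leq_pmulr _ _)) hi a_gt0.
have {}hi : #|V| <= 4 ^ i * a ^ 2 by apply: hi; rewrite expn_gt0 a_gt0.
elim: i a a_gt0 hi => [|i IH] a a_gt0 hi.
  exists set0; rewrite cards0; split=> // K _ _; apply: leq_trans (max_card _) _.
  by rewrite mul1n in hi.
have [||S [hS Sc]] := IH (2 * a); first by rewrite muln_gt0.
  by apply: leq_trans hi _; rewrite expnSr expnMn mulnA.
have hs : h * (2 * a) ^ 2 <= (h * (2 * a)) * (h * (2 * a)).
  rewrite -mulnn [X in _ <= X]mulnACA leq_mul2r; apply/orP; right.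
  by have [->|h_gt0] := posnP h; [|exact: leq_pmulr].
have [|S1 [N1 [hS1 hN1 Sc1]]] := halve_components (c := 2 * a ^ 2) hfree hs _ Sc.
  by rewrite expnMn mulnA.
have hs1 : h * (2 * a ^ 2) <= (h * (2 * a)) * (h * (2 * a)).
  by apply: leq_trans hs; rewrite leq_mul2l expnMn leq_mul2r //= !orbT.
have [|S2 [N2 [hS2 hN2 Sc2]]] := halve_components (c := a ^ 2) hfree hs1 _ Sc1 => //.
exists S2; split=> //; move: hS hS1 hS2 hN1 hN2; clear; rewrite !expnS !expn0 !muln1.
move: #|S| #|S1| #|S2| #|V| => x x1 x2 n hS hS1 hS2 hN1 hN2.
have e1 := leq_mul hS1 (leqnn a); have e2 := leq_mul hS2 (leqnn a).
have e3 := leq_mul (leqnn (h * h)) hN1; have e4 := leq_mul (leqnn (h * h)) hN2.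
lia.
Qed.

End Connected.

From mathcomp Require Import all_order all_algebra.
From mathcomp Require Import all_classical all_reals all_analysis.
From mathcomp Require Import ring lra.
Import Order.TTheory GRing.Theory Num.Theory.
Import numFieldNormedType.Exports.
Local Open Scope ring_scope.

(** * Crossing parity of polygonal walks *)

Section Crossings.
Variable R : realFieldType.
Implicit Types (a b c d o z x y : R * R) (s t L : seq (R * R)).

(** Twice the signed area of the triangle. *)
Definition area a b c : R :=
  (b.1 - a.1) * (c.2 - a.2) - (b.2 - a.2) * (c.1 - a.1).

Definition ccw a b c : bool := 0 < area a b c.

(* Parities are computed in the ring structure of [bool], i.e. in F_2. *)
Definition cross a b c d : bool :=
  (ccw a b c + ccw a b d) * (ccw c d a + ccw c d b).

(** A polygonal walk is given by its first vertex and the list of the later ones. *)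
Fixpoint cross_seg a b d t : bool :=
  if t is e :: t' then cross a b d e + cross_seg a b e t' else 0.

Fixpoint cross_walk a s d t : bool :=
  if s is b :: s' then cross_seg a b d t + cross_walk b s' d t else 0.

(* The third side is traversed backwards, hence the inequality. *)
Definition inside o a b d : bool :=
  (ccw o a d == ccw a b d) && (ccw a b d != ccw o b d).

(** In general position, this is the parity of the winding number about [d] of the closed walk from
    [o] through [a] and [s] back to [o]. *)
Fixpoint inside_fan o a s d : bool :=
  if s is b :: s' then inside o a b d + inside_fan o b s' d else 0.

Definition generic L :=
  {in L & &, forall x y z, x != y -> y != z -> x != z -> area x y z != 0}.

Lemma addbool_self (b : bool) : b + b = 0. Proof. by case: b. Qed.

Lemma area_rot a b c : area b c a = area a b c.
Proof. by rewrite /area; ring. Qed.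

Lemma area_swap a b c : area b a c = - area a b c.
Proof. by rewrite /area; ring. Qed.

Lemma ccw_rot a b c : ccw b c a = ccw a b c.
Proof. by rewrite /ccw area_rot. Qed.

Lemma ccw_swap a b c : area a b c != 0 -> ccw b a c = ~~ ccw a b c.
Proof. by move=> nz; rewrite /ccw area_swap oppr_gt0 -leNgt le_eqVlt (negPf nz). Qed.

Lemma ccw_diag a c : ccw a a c = false.
Proof. by rewrite /ccw (_ : area a a c = 0) ?ltxx // /area; ring. Qed.

Lemma cross_sym a b c d : cross a b c d = cross c d a b.
Proof. by rewrite /cross mulrC. Qed.

Lemma cross_diag a c d : cross a a c d = 0.
Proof. by rewrite /cross !ccw_diag mul0r. Qed.

Lemma cross_walk_consr a s d b t :
  cross_walk a s d (b :: t) = cross_seg d b a s + cross_walk a s b t.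
Proof.
elim: s a => [|x s IH] a /=; first by rewrite addr0.
by rewrite IH cross_sym; ring.
Qed.

Lemma cross_walk_sym a s d t : cross_walk a s d t = cross_walk d t a s.
Proof.
elim: t d => [|b t IH] d /=; first by elim: s a => //= x s IH a; rewrite IH.
by rewrite cross_walk_consr IH.
Qed.

Lemma mulr_sign_parity (u v : R) : u != 0 -> v != 0 -> (0 < u * v) = (0 < u) + (0 < v) + 1.
Proof.
rewrite !neq_lt => /orP[u0|u0] /orP[v0|v0]; rewrite ?u0 ?v0.
- by rewrite nmulr_rgt0 // v0 !ltNge !ltW.
- by rewrite nmulr_rgt0 // !ltNge !ltW.
- by rewrite pmulr_rgt0 // !ltNge !ltW.
- by rewrite pmulr_rgt0 // v0.
Qed.

(** A segment crosses the boundary of a triangle an odd number of times exactly when one of its ends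
    is inside. Nine orientations determine both sides; the sign patterns violating the identity are
    geometrically impossible. *)
Lemma cross_triangle L o a b d e :
  generic L -> o \in L -> a \in L -> b \in L -> d \in L -> e \in L ->
  {in [:: o; a; b], forall x, x != d} -> {in [:: o; a; b], forall x, x != e} ->
  cross o a d e + cross a b d e + cross o b d e = inside o a b d + inside o a b e.
Proof.
move=> gL oL aL bL dL eL hd he.
have [] : [/\ o != d, a != d & b != d] by split; apply: hd; rewrite !inE eqxx ?orbT.
have [] : [/\ o != e, a != e & b != e] by split; apply: he; rewrite !inE eqxx ?orbT.
move=> oe ae be od ad bd.
have sw x y w : x \in L -> y \in L -> w \in L -> x != w -> y != w ->
    x != y -> ccw y x w = ~~ ccw x y w.
  by move=> xL yL wL xw yw xy; apply: ccw_swap; apply: gL.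
have [<-|oa] := eqVneq o a.
  by rewrite cross_diag add0r addbool_self /inside !ccw_diag; do 2 case: ccw.
have [<-|ab] := eqVneq a b.
  by rewrite cross_diag addr0 addbool_self /inside !ccw_diag; do 2 case: ccw.
have [<-|ob] := eqVneq o b.
  rewrite cross_diag addr0 /inside /cross !(sw o a) // !ccw_diag.
  by do 4 case: ccw.
have [<-|de] := eqVneq d e.
  by rewrite !(cross_sym _ _ d d) !cross_diag !addbool_self.
have nz x y w : x \in L -> y \in L -> w \in L -> x != y -> y != w -> x != w ->
  area x y w != 0 by move=> *; apply: gL.
(* Barycentric coordinates write [area d e x * area o a b] as this alternating sum, which therefore
   vanishes for [x = d] and [x = e]. So the first and third products cannot share a sign opposite to
   that of the second. *)
have key x : x \in L -> o != x -> a != x -> b != x ->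
    area d e o * area a b x - area d e a * area o b x + area d e b * area o a x = 0 ->
    ~~ ((ccw d e o + ccw a b x == ccw d e a + ccw o b x + 1) &&
        (ccw d e o + ccw a b x == ccw d e b + ccw o a x)).
  move=> xL ox ax bx rel.
  have h1 : 0 < area d e o * area a b x = ccw d e o + ccw a b x + 1 :> bool.
    by apply: mulr_sign_parity; apply: nz; rewrite // eq_sym.
  have h2 : 0 < area d e a * area o b x = ccw d e a + ccw o b x + 1 :> bool.
    by apply: mulr_sign_parity; apply: nz; rewrite // eq_sym.
  have h3 : 0 < area d e b * area o a x = ccw d e b + ccw o a x + 1 :> bool.
    by apply: mulr_sign_parity; apply: nz; rewrite // eq_sym.
  have z2 : area d e a * area o b x != 0.
    by apply: mulf_neq0; apply: nz; rewrite // eq_sym.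
  apply/negP=> /andP[/eqP e1 /eqP e2]; rewrite e1 in e2; move: h1 h2 h3; rewrite e1 -e2.
  case: (_ + ccw o b x) => h1 h2 h3.
    have {}h1 : 0 < area d e o * area a b x by rewrite h1.
    have {}h3 : 0 < area d e b * area o a x by rewrite h3.
    have {h2} : ~~ (0 < area d e a * area o b x) by rewrite h2.
    rewrite -leNgt; lra.
  have {}h1 : ~~ (0 < area d e o * area a b x) by rewrite h1.
  have {}h3 : ~~ (0 < area d e b * area o a x) by rewrite h3.
  have {}h2 : 0 < area d e a * area o b x by rewrite h2.
  move: h1 h3; rewrite -!leNgt; lra.
have kd := key d dL od ad bd.
have {kd} /kd : area d e o * area a b d - area d e a * area o b d + area d e b * area o a d = 0.
  by rewrite /area; ring.
have ke := key e eL oe ae be.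
have {ke} /ke : area d e o * area a b e - area d e a * area o b e + area d e b * area o a e = 0.
  by rewrite /area; ring.
rewrite /cross /inside.
by do 9 case: ccw.
Qed.

Lemma cross_triangle_walk L o a b d t :
  generic L -> o \in L -> a \in L -> b \in L -> {subset d :: t <= L} ->
  {in [:: o; a; b] & d :: t, forall x y, x != y} ->
  cross_seg o a d t + cross_seg a b d t + cross_seg o b d t =
  inside o a b d + inside o a b (last d t).
Proof.
move=> gL oL aL bL; elim: t d => [|e t IH] d sL dis /=.
  by rewrite !addbool_self.
have <- : inside o a b d + inside o a b e +
    (inside o a b e + inside o a b (last e t)) = inside o a b d + inside o a b (last e t).
  by do 3 case: inside.
rewrite -IH; last first.
- by move=> x y hx hy; apply: dis => //; rewrite inE hy orbT.
- by move=> x hx; apply: sL; rewrite inE hx orbT.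
rewrite -(cross_triangle gL) //; try by apply: sL; rewrite !inE eqxx ?orbT.
- by ring.
- by move=> x hx; apply: dis; rewrite // inE eqxx.
- by move=> x hx; apply: dis; rewrite // !inE eqxx orbT.
Qed.

(** The triangle identity is summed over the triangles with apex [o] on the edges of the walk; every
    inner side at [o] belongs to two triangles and cancels modulo 2. *)
Lemma cross_fan L o a s d t :
  generic L -> o \in L -> {subset a :: s <= L} -> {subset d :: t <= L} ->
  {in [:: o, a & s] & d :: t, forall x y, x != y} ->
  cross_walk a s d t = cross_seg o a d t + cross_seg o (last a s) d t +
    inside_fan o a s d + inside_fan o a s (last d t).
Proof.
move=> gL oL; elim: s a => [|b s IH] a sL tL dis /=.
  by rewrite addbool_self !addr0.
rewrite IH //; last first.
- move=> x y hx hy; apply: dis => //; move: hx; rewrite !inE.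
  by case/or3P=> ->; rewrite ?orbT.
- by move=> x hx; apply: sL; rewrite inE hx orbT.
have h : inside o a b d + inside o a b (last d t) =
    cross_seg o a d t + cross_seg a b d t + cross_seg o b d t.
  rewrite -(cross_triangle_walk gL) //; try by apply: sL; rewrite !inE eqxx ?orbT.
  move=> x y hx hy; apply: dis => //; move: hx; rewrite !inE.
  by case/or3P=> ->; rewrite ?orbT.
have -> : cross_seg o a d t + cross_seg o (last b s) d t +
    (inside o a b d + inside_fan o b s d) +
    (inside o a b (last d t) + inside_fan o b s (last d t)) =
    (inside o a b d + inside o a b (last d t)) + cross_seg o a d t +
    cross_seg o (last b s) d t + inside_fan o b s d + inside_fan o b s (last d t) by ring.
rewrite h.
by do 4 case: cross_seg => //=; do 2 case: inside_fan.
Qed.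

Lemma cross_seg_diag o d t : cross_seg o o d t = 0.
Proof. by elim: t d => //= e t IH d; rewrite IH cross_diag. Qed.

(* Both walks are straightened, at the cost of terms that only depend on one
   walk and one end of the other. *)
Lemma cross_straighten L o s d t :
  generic L -> {subset o :: s <= L} -> {subset d :: t <= L} ->
  {in o :: s & d :: t, forall x y, x != y} ->
  cross_walk o s d t = cross o (last o s) d (last d t) +
    (inside_fan o o s d + inside_fan o o s (last d t)) +
    (inside_fan d d t o + inside_fan d d t (last o s)).
Proof.
move=> gL sL tL dis.
have lo : last o s \in o :: s by apply: mem_last.
have oo : o \in o :: s by rewrite inE eqxx.
have dd : d \in d :: t by rewrite inE eqxx.
rewrite (cross_fan (o := o) gL) //; [|exact: sL|]; last first.
  by move=> x y; rewrite inE => /orP[/eqP->|]; apply: dis.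
have -> : cross_seg o (last o s) d t = cross_walk o [:: last o s] d t by rewrite /= addr0.
rewrite cross_walk_sym (@cross_fan L d) //; last first.
- move=> x y; rewrite inE => hx hy; rewrite eq_sym; apply: dis.
    by move: hy; rewrite !inE => /orP[/eqP->|/eqP->].
  by case/orP: hx => [/eqP->|].
- by move=> x; rewrite !inE => /orP[/eqP->|/eqP->]; apply: sL.
- exact: tL.
by rewrite !cross_seg_diag /= (cross_sym d) addr0 !add0r; ring.
Qed.

(** One of the three pairings crosses when the points are in convex position, and none otherwise;
    the parity of the four orientations tells these cases apart. *)
Lemma cross_quad L a b c d :
  generic L -> uniq [:: a; b; c; d] -> {subset [:: a; b; c; d] <= L} ->
  cross a b c d + cross a c b d + cross a d b c =
  1 + ccw a b c + ccw a b d + ccw a c d + ccw b c d.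
Proof.
move=> gL; rewrite /= !inE !negb_or -!andbA => /and5P[ab ac ad bc /and3P[bd cd _]] sL.
have [] : [/\ a \in L, b \in L, c \in L & d \in L].
  by split; apply: sL; rewrite !inE eqxx ?orbT.
move=> aL bL cL dL; rewrite /cross.
have e1 : ccw a c b = ~~ ccw a b c.
  by rewrite (ccw_rot b a c) ccw_swap //; apply: gL.
have e2 : ccw a d b = ~~ ccw a b d.
  by rewrite (ccw_rot b a d) ccw_swap //; apply: gL.
have e3 : ccw a d c = ~~ ccw a c d.
  by rewrite (ccw_rot c a d) ccw_swap //; apply: gL.
have e4 : ccw b d c = ~~ ccw b c d.
  by rewrite (ccw_rot c b d) ccw_swap //; apply: gL.
rewrite e1 e2 e3 e4 !(ccw_rot a) !(ccw_rot b).
by do 4 case: ccw.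
Qed.

(* Any five points in general position span an odd number of crossing pairs of
   segments, and straightening does not change the parity of the total number
   of crossings of disjoint edges: every correction term occurs twice. *)
Lemma K5_walks_cross L (p : nat -> R * R) (w : nat -> nat -> seq (R * R)) :
  generic L ->
  (forall i j, (i < j < 5)%N -> {subset p i :: w i j <= L}) ->
  (forall i j, (i < j < 5)%N -> last (p i) (w i j) = p j) ->
  (forall i j k l, (i < j < 5)%N -> (k < l < 5)%N -> uniq [:: i; j; k; l] ->
    {in p i :: w i j & p k :: w k l, forall x y, x != y}) ->
  exists i j k l, [/\ (i < j < 5)%N, (k < l < 5)%N, uniq [:: i; j; k; l] &
    cross_walk (p i) (w i j) (p k) (w k l)].
Proof.
move=> gL sL lw dis; apply: contrapT => nocross.
pose f i j := inside_fan (p i) (p i) (w i j).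
have eqc i j k l : (i < j < 5)%N -> (k < l < 5)%N -> uniq [:: i; j; k; l] ->
    cross (p i) (p j) (p k) (p l) =
    f i j (p k) + f i j (p l) + (f k l (p i) + f k l (p j)).
  move=> ij kl u.
  have := cross_straighten gL (sL _ _ ij) (sL _ _ kl) (dis _ _ _ _ ij kl u).
  rewrite !lw // /f.
  have -> : cross_walk (p i) (w i j) (p k) (w k l) = false.
    by apply/negP=> h; apply: nocross; exists i, j, k, l.
  by case: cross; do 4 case: inside_fan.
pose W i j := p (minn i j) :: w (minn i j) (maxn i j).
have memW i j : i != j -> (i < 5)%N -> (j < 5)%N -> p i \in W i j.
  move=> ij i5 j5; rewrite /W; have [ltij|] := leqP i j; first by rewrite inE eqxx.
  by move=> ltji; rewrite -(lw j i) ?mem_last // ltji.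
(* Two further indices [k] and [l] make [i k] and [j l] disjoint edges, whose walks share no
   point. *)
have pneq i j : (i < 5)%N -> (j < 5)%N -> i != j -> p i != p j.
  move=> i5 j5 ij; pose r := [seq x <- iota 0 5 | (x != i) && (x != j)].
  have [k [l [k5 l5 u]]] : exists k l, [/\ (k < 5)%N, (l < 5)%N & uniq [:: i; k; j; l]].
    exists (nth 0%N r 0), (nth 0%N r 1); rewrite /r {r}.
    by move: i j i5 j5 ij => [|[|[|[|[|i]]]]] // [|[|[|[|[|j]]]]].
  move: u; rewrite /= !inE !negb_or => u.
  apply: (dis (minn i k) (maxn i k) (minn j l) (maxn j l)); try lia.
  - rewrite /= !inE !negb_or; lia.
  - by apply: memW => //; lia.
  - by apply: memW => //; lia.
have pL i : (i < 5)%N -> p i \in L.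
  case: i => [|i] i5; first by apply: (sL 0%N 1%N) => //; rewrite inE eqxx.
  by rewrite -(lw 0%N i.+1) //; apply: (sL 0%N i.+1) => //; rewrite mem_last.
have quad (a b c d : nat) : (a < b < c)%N -> (c < d < 5)%N ->
    cross (p a) (p b) (p c) (p d) + cross (p a) (p c) (p b) (p d) +
    cross (p a) (p d) (p b) (p c) =
    1 + ccw (p a) (p b) (p c) + ccw (p a) (p b) (p d) + ccw (p a) (p c) (p d) +
    ccw (p b) (p c) (p d).
  move=> abc cd5; apply: (cross_quad gL).
    by rewrite /= !inE !negb_or !pneq //; lia.
  by move=> x; rewrite !inE => /or4P[] /eqP->; apply: pL; lia.
have q0 := quad 1 2 3 4 isT isT; have q1 := quad 0 2 3 4 isT isT.
have q2 := quad 0 1 3 4 isT isT; have q3 := quad 0 1 2 4 isT isT.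
have q4 := quad 0 1 2 3 isT isT.
rewrite !eqc // in q0 q1 q2 q3 q4.
suff : (1 : bool) = 0 by [].
have := congr2 +%R (congr2 +%R (congr2 +%R (congr2 +%R q0 q1) q2) q3) q4.
have two (x : bool) : x * 2 = 0 by rewrite mulr_natr mulr2n addbool_self.
(* Every [f i j (p k)] and every triple occurs in two of the five quadruples; the five ones
   contribute [1 + 2 * 2]. *)
pose g v := let: (i, j, k, l, m) := v in f i j (p k) + f i j (p l) + f i j (p m).
pose c v := let: (i, j, k) := v in ccw (p i) (p j) (p k).
rewrite [LHS](_ : _ = (\sum_(v <- [:: (0, 1, 2, 3, 4); (0, 2, 1, 3, 4);
  (0, 3, 1, 2, 4); (0, 4, 1, 2, 3); (1, 2, 0, 3, 4); (1, 3, 0, 2, 4);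
  (1, 4, 0, 2, 3); (2, 3, 0, 1, 4); (2, 4, 0, 1, 3); (3, 4, 0, 1, 2)]%N) g v) * 2);
  last by rewrite !big_cons big_nil /g; ring.
rewrite [RHS](_ : _ = 1 + (2 + \sum_(v <- [:: (0, 1, 2); (0, 1, 3); (0, 1, 4);
  (0, 2, 3); (0, 2, 4); (0, 3, 4); (1, 2, 3); (1, 2, 4); (1, 3, 4); (2, 3, 4)]%N) c v) * 2);
  last by rewrite !big_cons big_nil /c; ring.
by rewrite !two addr0.
Qed.

(** * Crossing segments meet *)

Lemma opposite_ratio (u v : R) : ((0 < u) + (0 < v))%R ->
  u - v != 0 /\ 0 <= u / (u - v) <= 1.
Proof.
have [hu|hu] := ltP 0 u; have [hv|hv] := ltP 0 v => // _.
  have huv : 0 < u - v by lra.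
  split; first by rewrite gt_eqF.
  by apply/andP; split; [apply: divr_ge0; lra|rewrite ler_pdivrMr //; lra].
have huv : u - v < 0 by lra.
split; first by rewrite lt_eqF.
apply/andP; split; last by rewrite ler_ndivrMr //; lra.
by apply: mulr_le0 => //; rewrite invr_le0 ltW.
Qed.

Lemma cross_meet a b c d : cross a b c d ->
  exists t u : R, [/\ 0 <= t <= 1, 0 <= u <= 1,
    a.1 + t * (b.1 - a.1) = c.1 + u * (d.1 - c.1) &
    a.2 + t * (b.2 - a.2) = c.2 + u * (d.2 - c.2)].
Proof.
case/andP=> /opposite_ratio[n1 h1] /opposite_ratio[n2 h2].
(* Along [a b] the affine function [area c d] goes from [area c d a] to [area c d b]; [t] is the
   parameter of its zero, and [u] is the same for [c d]. *)
exists (area c d a / (area c d a - area c d b)), (area a b c / (area a b c - area a b d)).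
move: n1 n2; split=> //; rewrite /area in n1 n2 *; field; exact/andP.
Qed.

Lemma cross_near a b c d (r : R) : cross a b c d ->
  `|b.1 - a.1| <= r -> `|b.2 - a.2| <= r -> `|d.1 - c.1| <= r -> `|d.2 - c.2| <= r ->
  `|a.1 - c.1| <= 2 * r /\ `|a.2 - c.2| <= 2 * r.
Proof.
move=> /cross_meet[t [u [t01 u01 e1 e2]]] b1 b2 d1 d2.
have sc (v x : R) : 0 <= v <= 1 -> `|x| <= r -> `|v * x| <= r.
  case/andP=> v0 v1 xr; rewrite normrM ger0_norm //.
  by apply: le_trans xr; rewrite -[leRHS]mul1r ler_wpM2r.
split.
  have -> : a.1 - c.1 = u * (d.1 - c.1) - t * (b.1 - a.1).
    by move: e1; move: (t * _) (u * _) => x y; lra.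
  by apply: le_trans (ler_normB _ _) _; rewrite mulr_natl mulr2n lerD // sc.
have -> : a.2 - c.2 = u * (d.2 - c.2) - t * (b.2 - a.2).
  by move: e2; move: (t * _) (u * _) => x y; lra.
by apply: le_trans (ler_normB _ _) _; rewrite mulr_natl mulr2n lerD // sc.
Qed.

(** * Perturbation into general position *)

Lemma poly_small_nonroot (P : {poly R}) (r : R) : 0 < r -> P != 0 ->
  exists2 x : R, 0 < x < r & P.[x] != 0.
Proof.
move=> r0 P0; apply: contrapT => H.
(* These values are distinct and strictly between 0 and [r]; [size P] of them cannot all be
   roots. *)
pose v i : R := r / (i.+2)%:R.
have vinj : injective v.
  have r_neq0 : r != 0 by rewrite gt_eqF.
  by move=> i j /(mulfI r_neq0) /invr_inj /eqP; rewrite eqr_nat => /eqP[].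
have := max_poly_roots P0 (rs := [seq v i | i <- iota 0 (size P)]).
rewrite size_map size_iota ltnn => contra.
suff: false by [].
apply: contra.
  apply/allP=> x /mapP[i _ ->]; apply: contraT => nr; case: H; exists (v i) => //.
  rewrite /v divr_gt0 ?ltr0n //= ltr_pdivrMr ?ltr0n //.
  by rewrite ltr_pMr // ltr1n.
by rewrite map_inj_uniq // iota_uniq.
Qed.

Definition near_by (r : R) x y := (`|x.1 - y.1| < r) && (`|x.2 - y.2| < r).

(* A line meets the parabola arc [s |-> (q.1 + s, q.2 + s ^+ 2)] at most twice. *)
Lemma avoid_lines (q : R * R) (r : R) L : 0 < r ->
  exists q', [/\ near_by r q' q, q' \notin L &
    {in L &, forall x y, x != y -> area x y q' != 0}].
Proof.
move=> r0.
(* [P1 x] vanishes where the arc point has the abscissa of [x], and [P2 x y] where it lies on the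
   line through [x] and [y]. *)
pose P1 x : {poly R} := 'X + (q.1 - x.1)%:P.
pose P2 (x y : R * R) : {poly R} := (y.1 - x.1)%:P * ('X^2 + (q.2 - x.2)%:P) -
                      (y.2 - x.2)%:P * ('X + (q.1 - x.1)%:P).
pose P := \prod_(x <- L) (P1 x * \prod_(y <- L | x != y) P2 x y).
have P1n x : P1 x != 0 by rewrite -size_poly_gt0 size_XaddC.
have P2n x y : x != y -> P2 x y != 0.
  move=> xy; apply/eqP=> /polyP H.
  have := H 2%N; have := H 1%N; rewrite /P2 !(coefB, coefCM, coefD, coefXn, coefX, coefC) /=.
  rewrite !(addr0, mulr0, mulr1, subr0, add0r, sub0r) => /eqP; rewrite oppr_eq0 subr_eq0.
  move=> /eqP e2 /eqP; rewrite subr_eq0 => /eqP e1; case/eqP: xy.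
  by case: x y e1 e2 {H} => [x1 x2] [y1 y2] /= -> ->.
(* A parameter below 1 exceeds its square, so both displacements stay below [r]. *)
have [||x /andP[x0 xr]] := @poly_small_nonroot P (Num.min r 1); first by rewrite lt_min r0 ltr01.
  rewrite /P prodf_seq_neq0; apply/allP=> x _ /=; rewrite mulf_neq0 //.
  by rewrite prodf_seq_neq0; apply/allP=> y _; apply/implyP; apply: P2n.
rewrite /P horner_prod prodf_seq_neq0 => /allP /= nz.
move: xr; rewrite lt_min => /andP[xr x1].
exists (q.1 + x, q.2 + x ^+ 2); split.
- rewrite /near_by /= ![_ + _ - _]addrAC !subrr !add0r !ger0_norm ?exprn_ge0 ?ltW //= xr /=.
  apply: lt_trans xr; rewrite expr2; nra.
- apply/negP=> hL; have /= := nz _ hL; rewrite hornerM mulf_eq0 negb_or => /andP[].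
  by rewrite /P1 !hornerE /= => /eqP nz1 _; apply: nz1; ring.
move=> a b aL bL ab; have /= := nz _ aL; rewrite hornerM mulf_eq0 negb_or => /andP[_].
rewrite horner_prod prodf_seq_neq0 => /allP /(_ b bL); rewrite ab /=.
rewrite /P2 !hornerE /= /area /=; apply: contra => /eqP <-; apply/eqP; ring.
Qed.

(** Points are moved one at a time, each off the points already placed and off the lines through
    them; a repeated point keeps its image. *)
Lemma perturb_generic L (r : R) : 0 < r ->
  exists f : R * R -> R * R, [/\ {in L, forall x, near_by r (f x) x},
    {in L &, injective f} & generic [seq f x | x <- L]].
Proof.
move=> r0; elim: L => [|q L [f [fr finj fgen]]].
  by exists id; split=> // x y z.
have [qL|qL] := boolP (q \in L).
  have sub x : x \in q :: L -> x \in L by rewrite inE => /orP[/eqP->|].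
  exists f; split.
  - by move=> x /sub; apply: fr.
  - by move=> x y /sub xL /sub yL; apply: finj.
  have sub' x : x \in [seq f x | x <- q :: L] -> x \in [seq f x | x <- L].
    by move=> /mapP[y /sub yL ->]; apply: map_f.
  by move=> x y z /sub' xL /sub' yL /sub' zL; apply: fgen.
have [q' [q'r q'L q'lin]] := avoid_lines q [seq f x | x <- L] r0.
pose f' x := if x == q then q' else f x.
have f'q : f' q = q' by rewrite /f' eqxx.
have f'L x : x \in L -> f' x = f x.
  by move=> xL; rewrite /f'; case: eqP => // xq; rewrite -xq xL in qL.
have mapf' : [seq f' x | x <- q :: L] = q' :: [seq f x | x <- L].
  by rewrite /= f'q; congr cons; apply/eq_in_map => x /f'L.
exists f'; split.
- move=> x; rewrite inE => /orP[/eqP->|xL]; first by rewrite f'q.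
  by rewrite f'L //; apply: fr.
- move=> x y; rewrite !inE => /orP[/eqP->|xL] /orP[/eqP->|yL] //.
  + by rewrite f'q f'L // => e; case/negP: q'L; rewrite e map_f.
  + by rewrite f'q f'L // => e; case/negP: q'L; rewrite -e map_f.
  + by rewrite !f'L //; apply: finj.
rewrite mapf' => x y z; rewrite !inE.
move=> /orP[/eqP->|xL] /orP[/eqP->|yL] /orP[/eqP->|zL] xy yz xz;
  try by rewrite eqxx in xy.
- by rewrite eqxx in xz.
- by rewrite -area_rot; apply: q'lin.
- by rewrite eqxx in yz.
- by rewrite area_rot; apply: q'lin; rewrite // eq_sym.
- exact: q'lin.
- exact: fgen.
Qed.

End Crossings.

(** * Planar graphs have no K5 minor *)

Section Graphs.
Variable G : sgraph.

Lemma connect_induced (A : {set G}) (u v : induced_subgraph A) :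
  connect adj u v -> connect (restr adj A) (val u) (val v).
Proof.
case/connectP=> s + ->; elim: s u => [|w s IH] u /=; first by rewrite connect0.
move=> /andP[uw ws]; apply: connect_trans (IH _ ws); apply: connect1.
by rewrite /restr (valP u) (valP w).
Qed.

Lemma connect_restr_induced (A : {set G}) (u v : induced_subgraph A) :
  connect (restr adj A) (val u) (val v) -> connect adj u v.
Proof.
case/connectP=> s; elim: s u => [|w s IH] u /=.
  by move=> _ /val_inj ->; rewrite connect0.
move=> /andP[/and3P[uA wA uw] ws] e.
apply: (@connect_trans _ _ (exist _ w wA : induced_subgraph A)).
  exact: connect1.
exact: IH.
Qed.

Lemma connected_inducedP (A : {set G}) :
  connected_graph (induced_subgraph A) <-> conn adj A.
Proof.
split=> [[/card_gt0P[x _] h]|/connP[[x xA] h]].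
  apply/connP; split; first by exists (val x); exact: (valP x).
  by move=> a b aA bA; apply: (connect_induced (h (exist _ a aA) (exist _ b bA))).
split; first by apply/card_gt0P; exists (exist _ x xA).
by move=> u v; apply: connect_restr_induced; apply: h; apply: valP.
Qed.

Lemma conn_union (A B : {set G}) :
  conn adj A -> conn adj B -> touch adj A B -> conn adj (A :|: B).
Proof.
move=> /connP[[x0 x0A] cA] /connP[_ cB] /touchP[x [y [xA yB xy]]].
have h a : a \in A :|: B -> connect (restr adj (A :|: B)) x a.
  case/setUP=> [aA|aB]; first exact: connect_restrS (finset.subsetUl _ _) (cA _ _ xA aA).
  apply: (connect_trans (y := y)); last exact: connect_restrS (finset.subsetUr _ _) (cB _ _ yB aB).
  by apply: connect1; rewrite /restr !inE xA yB orbT.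
apply/connP; split; first by exists x; rewrite inE xA.
move=> a b /h ha /h hb; apply: connect_trans hb.
by rewrite (restr_sym (@adj_sym G)).
Qed.

End Graphs.

Fact complete_adj_sym h : symmetric (fun x y : 'I_h => x != y).
Proof. by move=> x y; rewrite eq_sym. Qed.

Fact complete_adj_irrefl h : irreflexive (fun x y : 'I_h => x != y).
Proof. by move=> x; rewrite eqxx. Qed.

Definition complete h : sgraph := SGraph (@complete_adj_sym h) (@complete_adj_irrefl h).

(** An odd sum has an odd term. The crossing segments are named by their unperturbed ends, so that
    the step bound [e] still applies to them. *)
Lemma cross_walk_map (R : realFieldType) (f : R * R -> R * R) (e : rel (R * R)) a s d t :
  path e a s -> path e d t -> cross_walk (f a) (map f s) (f d) (map f t) ->
  exists x x' y y', [/\ e x x', e y y', {subset [:: x; x'] <= a :: s},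
    {subset [:: y; y'] <= d :: t} & cross (f x) (f x') (f y) (f y')].
Proof.
have sub (A : eqType) (x y u : A) r : {subset [:: x; y] <= r} -> {subset [:: x; y] <= u :: r}.
  by move=> h z /h; rewrite inE => ->; rewrite orbT.
have sub2 (A : eqType) (x y : A) r : {subset [:: x; y] <= [:: x, y & r]}.
  by move=> z; rewrite !inE => /orP[] ->; rewrite ?orbT.
move=> + pt; elim: s a => [//|b s IH] a /= /andP[ab bs].
case E : (cross_seg (f a) (f b) (f d) (map f t)); last first.
  move=> h; have [|x [x' [y [y' [h1 h2 h3 h4 h5]]]]] := IH b bs; first by rewrite add0r in h.
  by exists x, x', y, y'; split=> //; apply: sub.
move=> _ {IH}.
suff [y [y' [h1 h2 h3]]] : exists y y', [/\ e y y', {subset [:: y; y'] <= d :: t} &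
    cross (f a) (f b) (f y) (f y')] by exists a, b, y, y'; split.
elim: t d pt E => [//|c t IH] d /= /andP[dc ct].
case E : (cross _ _ _ _); first by move=> _; exists d, c; split.
rewrite add0r => /(IH _ ct)[y [y' [h1 h2 h3]]].
by exists y, y'; split=> //; apply: sub.
Qed.

(** * Chains of small steps and distances between compact sets *)

Section Plane.
Variable R : realType.
Local Open Scope classical_set_scope.
Implicit Types (a b x y : R * R) (A B : set (R * R)) (r : R).

Lemma near_by_refl r x : 0 < r -> near_by r x x.
Proof. by move=> r0; rewrite /near_by !subrr normr0 r0. Qed.

Lemma near_by_sym r x y : near_by r x y = near_by r y x.
Proof. by rewrite /near_by (distrC x.1) (distrC x.2). Qed.

Lemma ballE r x y : ball x r y <-> near_by r x y.
Proof. by split=> [[h1 h2]|/andP[h1 h2]]; [apply/andP|]; split. Qed.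

(** A discrete substitute for a path: only the vertices have to lie in [A], not the segments between
    them. *)
Definition chain A r a b := exists s, [/\ path (near_by r) a s, last a s = b &
  forall x, x \in a :: s -> A x].

Lemma chain_trans A r a b c : chain A r a b -> chain A r b c -> chain A r a c.
Proof.
move=> [s [ps <- sA]] [t [pt <- tA]]; exists (s ++ t); split.
- by rewrite cat_path ps.
- by rewrite last_cat.
move=> x; rewrite -cat_cons mem_cat => /orP[/sA//|xt]; apply: tA.
by rewrite inE xt orbT.
Qed.

Lemma chain_sub A B r a b : A `<=` B -> chain A r a b -> chain B r a b.
Proof. by move=> AB [s [ps ls sA]]; exists s; split=> // x /sA /AB. Qed.

(** The points of [A] reachable from [a] form a subset that is both relatively open and relatively
    closed. *)
Lemma connected_chain A r a b : 0 < r -> connected A -> A a -> A b -> chain A r a b.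
Proof.
move=> r0 cA Aa Ab; pose B := [set x | A x /\ chain A r a x].
have Ba : B a by split=> //; exists [::]; split=> // x; rewrite inE => /eqP ->.
have step x y : B x -> A y -> near_by r x y -> B y.
  move=> [Ax cx] Ay xy; split=> //; apply: chain_trans cx _.
  exists [:: y]; split; rewrite /= ?xy // => z; rewrite !inE => /orP[] /eqP -> //.
suff BA : B = A by have [] : B b by rewrite BA.
apply: cA; first by exists a.
- exists (\bigcup_(x in B) ball x r).
    by apply: bigcup_open => x _; exact: ball_open.
  apply/seteqP; split=> [x Bx|y [Ay [x Bx /ballE xy]]]; last exact: step xy.
  by split; [case: Bx|exists x => //; apply/ballE; apply: near_by_refl].
- exists (closure B); first exact: closed_closure.
  apply/seteqP; split=> [x Bx|y [Ay By]].
    by split; [case: Bx|exact: subset_closure].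
  have [x [Bx /ballE xy]] := By (ball y r) (nbhsx_ballx y r r0).
  by apply: step Bx Ay _; rewrite near_by_sym.
Qed.

(** Each point of [A] has a ball missing [B]; half the radius serves all points of the ball of half
    the radius, and compactness of [A] makes the choice uniform. *)
Lemma disjoint_compact_dist A B : compact A -> compact B -> A `&` B = set0 ->
  exists2 r, 0 < r & forall x y, A x -> B y -> ~~ near_by r x y.
Proof.
move=> cA cB AB.
have clB : closed B by apply: compact_closed cB; exact: norm_hausdorff.
have /compact_near_coveringP ncA := cA.
have := ncA R (0^'+) (fun r x => forall y, B y -> ~~ near_by r x y) _.
case.
  move=> x Ax; have : nbhs x (~` B).
    apply: open_nbhs_nbhs; split; first exact: closed_openC.
    by move=> Bx; have : (A `&` B) x by []; rewrite AB.
  move=> /nbhs_ballP[r /= r0 rB].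
  exists (ball x (r / 2), [set s | s < r / 2]).
    split; first by apply: nbhsx_ballx; rewrite divr_gt0.
    by apply: nbhs_right_lt; rewrite divr_gt0.
  move=> [z s] /= [/ballE xz sr] y By; apply/negP=> zy; apply: (rB y) => //.
  apply/ballE; move: xz zy => /andP[h1 h2] /andP[h3 h4]; apply/andP; split.
    apply: le_lt_trans (ler_distD z.1 _ _) _; lra.
  apply: le_lt_trans (ler_distD z.2 _ _) _; lra.
move=> r /= r0 rP; exists (r / 2); first by rewrite divr_gt0.
move=> x y Ax By; apply: rP => //=; last by rewrite divr_gt0.
by rewrite sub0r normrN gtr0_norm ?divr_gt0 //; lra.
Qed.

Lemma uniform_pos (I : finType) (P : I -> R -> Prop) :
  (forall i r s, s <= r -> P i r -> P i s) ->
  (forall i, exists2 r, 0 < r & P i r) -> exists2 r, 0 < r & forall i, P i r.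
Proof.
move=> mono exr.
suff [r r0 hr] : exists2 r, 0 < r & forall i, i \in enum I -> P i r.
  by exists r => // i; apply: hr; rewrite mem_enum.
elim: (enum I) => [|i s [r r0 hr]]; first by exists 1.
have [q q0 hq] := exr i; exists (Num.min q r); first by rewrite lt_min q0.
move=> j; rewrite inE => /orP[/eqP->|/hr hj].
  by apply: mono hq; rewrite ge_min lexx.
by apply: mono hj; rewrite ge_min lexx orbT.
Qed.

Lemma arc_compact a b A : is_arc a b A -> compact A.
Proof.
move=> [g [gc _ _ _ ->]]; apply: continuous_compact gc _; exact: segment_compact.
Qed.

Lemma arc_connected a b A : is_arc a b A -> connected A.
Proof.
move=> [g [gc _ _ _ ->]]; apply: connected_continuous_connected gc.
exact: segment_connected.
Qed.

Lemma arc_ends a b A : is_arc a b A -> A a /\ A b.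
Proof.
move=> [g [_ _ <- <- ->]]; split; [exists 0|exists 1] => //=;
  by rewrite in_itv /= lexx ler01.
Qed.

End Plane.

Lemma planar_K5_minor_free (R : realType) (G : sgraph) :
  planar R G -> ~ minor (complete 5) G.
Proof.
move=> [p [arc [_ arcP _ arcI]]] [phi [phiC phiD phiA]].
have {}phiC x : conn adj (phi x) by apply/connected_inducedP.
pose drawn (A : {set G}) : set (R * R) :=
  [set z | exists u v, [/\ u \in A, v \in A, adj u v & arc [set u; v]%SET z]]%classic.
have [r r0 rP] : exists2 r : R, 0 < r & forall A B : {set G}, [disjoint A & B] ->
    forall x y, drawn A x -> drawn B y -> ~~ near_by r x y.
  have [r r0 rP] : exists2 r : R, 0 < r & forall e : G * G * (G * G),
      adj e.1.1 e.1.2 -> adj e.2.1 e.2.2 ->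
      [disjoint [set e.1.1; e.1.2]%SET & [set e.2.1; e.2.2]%SET] ->
      forall x y, arc [set e.1.1; e.1.2]%SET x -> arc [set e.2.1; e.2.2]%SET y ->
      ~~ near_by r x y.
    apply: uniform_pos => [e q s sq H h1 h2 h3 x y h4 h5|[[u v] [w z]] /=].
      apply: contra (H h1 h2 h3 x y h4 h5) => /andP[k1 k2]; apply/andP.
      by split; [apply: lt_le_trans k1 sq|apply: lt_le_trans k2 sq].
    have [uv|] := boolP (adj u v); last by exists 1.
    have [wz|] := boolP (adj w z); last by exists 1.
    have [dis|] := boolP [disjoint [set u; v]%SET & [set w; z]%SET]; last by exists 1.
    have [|r r0 rP] :=
      disjoint_compact_dist (arc_compact (arcP _ _ uv)) (arc_compact (arcP _ _ wz)).
      apply/seteqP; split=> // x [x1 x2].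
      have [e|y _] := arcI _ _ _ _ uv wz _ x x1 x2.
        by move: dis; rewrite e (@meet_not_disjoint _ _ _ w) // !inE eqxx.
      by move: dis; rewrite -setI_eq0 => /eqP ->; rewrite inE.
    by exists r.
  exists r => // A B dAB x y [u [v [uA vA uv xa]]] [w [z [wB zB wz ya]]].
  apply: (rP (u, v, (w, z))) => //=.
  apply: (disjointW _ _ dAB); apply/fintype.subsetP=> t; rewrite !inE => /orP[] /eqP-> //.
(* Steps and perturbations are below [q], so perturbed steps are at most [3 * q]. Starting points of
   crossing steps then differ by at most [6 * q] per coordinate, and their originals by less than
   [8 * q = r]. *)
pose q := r / 8.
have q0 : 0 < q by rewrite divr_gt0.
have edge_chain (A : {set G}) u v : u \in A -> v \in A -> adj u v -> chain (drawn A) q (p u) (p v).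
  move=> uA vA uv; have [au av] := arc_ends (arcP _ _ uv).
  apply: chain_sub (connected_chain q0 (arc_connected (arcP _ _ uv)) au av).
  by move=> x; exists u, v.
have walk_chain (A : {set G}) u v : connect (restr adj A) u v -> u != v ->
    chain (drawn A) q (p u) (p v).
  case/connectP=> s; elim: s u => [|w s IH] u /=; first by move=> _ ->; rewrite eqxx.
  move=> /andP[/and3P[uA wA uw] ws] e uv; have cuw := edge_chain _ _ _ uA wA uw.
  have [wv|wv] := eqVneq w v; first by rewrite -wv.
  exact: chain_trans cuw (IH w ws e wv).
pose F (i : nat) := phi (inord i : 'I_5).
have /choice[b bP] : forall i, exists v, v \in F i.
  by move=> i; have [] := connP _ _ (phiC (inord i : 'I_5)).
have inord_neq i j : (i < 5)%N -> (j < 5)%N -> i != j -> (inord i : 'I_5) != inord j.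
  by move=> i5 j5; apply: contra => /eqP/(congr1 val) /=; rewrite !inordK // => ->.
have Fdis i j : (i < 5)%N -> (j < 5)%N -> i != j -> [disjoint F i & F j].
  by move=> i5 j5 ij; apply: phiD; apply: inord_neq.
(* An edge [i j] of K5 becomes a chain drawn inside [F i :|: F j]. Four distinct indices give
   disjoint unions, so no point of one chain is [r]-near a point of the other. *)
have /choice[w wP] : forall ij : nat * nat, exists s, (ij.1 < ij.2 < 5)%N ->
    [/\ path (near_by q) (p (b ij.1)) s, last (p (b ij.1)) s = p (b ij.2) &
        forall x, x \in p (b ij.1) :: s -> drawn (F ij.1 :|: F ij.2) x].
  move=> [i j] /=.
  case: (boolP (i < j < 5)%N) => [ij|]; last by exists [::].
  have ineq : i != j by lia.
  have i5 : (i < 5)%N by lia.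
  have j5 : (j < 5)%N by lia.
  have /connP[_ cij] : conn adj (F i :|: F j).
    apply: conn_union; rewrite ?phiC //; apply/touchP.
    exact: (phiA _ _ (inord_neq _ _ i5 j5 ineq)).
  have [|||s [h1 h2 h3]] := walk_chain _ _ _ (cij (b i) (b j) _ _) _; last by exists s.
  - by rewrite inE bP.
  - by rewrite inE bP orbT.
  - by apply: contraTneq (Fdis i j i5 j5 ineq) => e; rewrite (meet_not_disjoint (bP i)) // e bP.
pose W i j := w (i, j).
have far i j k l x y : (i < j < 5)%N -> (k < l < 5)%N -> uniq [:: i; j; k; l] ->
    x \in p (b i) :: W i j -> y \in p (b k) :: W k l -> ~~ near_by r x y.
  move=> ij kl u xi yk; have [_ _ dx] := wP (i, j) ij; have [_ _ dy] := wP (k, l) kl.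
  apply: rP (dx _ xi) (dy _ yk); move: u; rewrite /= !inE !negb_or => u.
  apply/pred0P=> z /=; apply/negP; rewrite !inE.
  have nF m n : (m < 5)%N -> (n < 5)%N -> m != n -> z \in F m -> z \in F n -> False.
    by move=> m5 n5 /(Fdis _ _ m5 n5) + zm zn; rewrite (meet_not_disjoint zm zn).
  by case/andP=> /orP[] h1 /orP[] h2; apply: (nF _ _ _ _ _ h1 h2); lia.
pose L := flatten [seq p (b i) :: W i j | i <- iota 0 5, j <- iota 0 5].
have subL i j : (i < j < 5)%N -> {subset p (b i) :: W i j <= L}.
  move=> ij x xW; apply/flattenP; exists (p (b i) :: W i j) => //.
  by apply/allpairsP; exists (i, j); rewrite !mem_iota; split=> //=; lia.
have [f [fq finj fgen]] := perturb_generic L q0.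
have [|||i [j [k [l [ij kl u]]]]] :=
  @K5_walks_cross _ _ (fun i => f (p (b i))) (fun i j => [seq f x | x <- W i j]) fgen.
- move=> i j ij x; rewrite -map_cons => /mapP[y yW ->]; apply: map_f; exact: (subL i j).
- by move=> i j ij; rewrite last_map; have [_ -> _] := wP (i, j) ij.
- move=> i j k l ij kl u x y; rewrite -!map_cons => /mapP[x' x'W ->] /mapP[y' y'W ->].
  apply: contra (far _ _ _ _ _ _ ij kl u x'W y'W) => /eqP/finj ->.
  + exact: near_by_refl.
  + exact: subL x'W.
  + exact: subL y'W.
have [pij _ _] := wP (i, j) ij; have [pkl _ _] := wP (k, l) kl.
move=> /(cross_walk_map pij pkl)[x [x' [y [y' [xx' yy' sx sy]]]]].
have mx z : z \in [:: x; x'] -> near_by q (f z) z by move=> /sx /(subL _ _ ij) /fq.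
have my z : z \in [:: y; y'] -> near_by q (f z) z by move=> /sy /(subL _ _ kl) /fq.
have xW : x \in p (b i) :: W i j by apply: sx; rewrite inE eqxx.
have yW : y \in p (b k) :: W k l by apply: sy; rewrite inE eqxx.
have : near_by q (f x) x by apply: mx; rewrite inE eqxx.
have : near_by q (f x') x' by apply: mx; rewrite !inE eqxx orbT.
have : near_by q (f y) y by apply: my; rewrite inE eqxx.
have : near_by q (f y') y' by apply: my; rewrite !inE eqxx orbT.
have := far _ _ _ _ _ _ ij kl u xW yW; move: xx' yy'.
rewrite /near_by => /andP[xx1 xx2] /andP[yy1 yy2] nxy.
move=> /andP[a1 a2] /andP[b1 b2] /andP[c1 c2] /andP[d1 d2] cr.
have tri (s t s' t' : R) : `|s' - s| < q -> `|t' - t| < q -> `|s - t| < q -> `|t' - s'| <= 3 * q.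
  by rewrite !ltr_norml ler_norml; lra.
have [e1 e2] := cross_near cr (tri _ _ _ _ d1 c1 xx1) (tri _ _ _ _ d2 c2 xx2)
  (tri _ _ _ _ b1 a1 yy1) (tri _ _ _ _ b2 a2 yy2).
have fin (s t s' t' : R) : `|s' - s| < q -> `|t' - t| < q ->
    `|s' - t'| <= 2 * (3 * q) -> `|s - t| < r.
  rewrite (_ : r = 8 * q); last by rewrite /q; field.
  by rewrite !ltr_norml ler_norml; lra.
by move: nxy; rewrite (fin _ _ _ _ d1 b1 e1) (fin _ _ _ _ d2 b2 e2).
Qed.

(** * Fragmentation and the impossibility results *)

(* When every vertex reports exactly the members of [S] as corrupt, the corrupt
   set may be [S], or [S] together with any one component of [G - S]. *)
Lemma fragmentable_no_algorithm (R : realType) (G : sgraph) (eps : R) :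
  fragmentable G eps -> no_algorithm G eps.
Proof.
move=> [S [hS hc]] [alg algP].
pose r : reports G := [ffun e => (val e).2 \notin S].
have compl (T : {set G}) : ~: T :|: T = [set: G]%SET /\ [disjoint ~: T & T].
  split; first by rewrite finset.setUC finset.setUCr.
  by rewrite -finset.setI_eq0 finset.setIC finset.setICr.
have large (T : {set G}) : #|T|%:R <= 2 * eps * #|G|%:R ->
    (1 - 2 * eps) * #|G|%:R <= #|~: T|%:R.
  by rewrite -(cardsC T) natrD => h; lra.
have [tc1 tc2] := compl S.
have S2 : #|S|%:R <= 2 * eps * #|G|%:R.
  by have := ler0n R #|S|; lra.
have [|t rt] := algP _ _ tc1 tc2 (large _ S2) r; first by move=> e _; rewrite ffunE inE.
(* The vertex [t] named when the corrupt set is [S] lies outside [S]; its component is now made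
   corrupt as well, under the same reports. *)
move=> tS; pose t' : remove S := exist _ t tS.
pose D := [set val v | v in component t'].
have hD : #|D|%:R <= eps * #|G|%:R by rewrite card_imset ?hc //; exact: val_inj.
have tD : t \in D by apply/imsetP; exists t' => //; rewrite inE connect0.
have SD2 : #|S :|: D|%:R <= 2 * eps * #|G|%:R.
  have : #|S :|: D|%:R <= #|S|%:R + #|D|%:R :> R by rewrite -natrD ler_nat leq_card_setU.
  by lra.
have [d1 d2] := compl (S :|: D).
have [|t2] := algP _ _ d1 d2 (large _ SD2) r.
  (* A vertex [u] outside [S] and [D] has no neighbour in the component [D], so its reports, which
     accuse only [S], remain true. *)
  move=> [[u v] /= uv]; rewrite ffunE /= !inE !negb_or => /andP[uS uD].
  case: (boolP (v \in S)) => //= vS; apply/esym/negP=> /imsetP[v' v't' ev].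
  case/negP: uD; apply/imsetP.
  have uS' : u \in ~: S by rewrite inE.
  exists (exist _ u uS') => //; move: v't'; rewrite !inE => v't'.
  apply: connect_trans v't' (connect1 _).
  by rewrite /= /induced_adj /= -ev adj_sym.
by rewrite rt => -[<-]; rewrite !inE tD orbT.
Qed.

(** [H] is a subgraph of the complete graph on [#|H|] vertices, so a clique model of that size, with
    members assigned in any order, is a model of [H]. *)
Lemma minor_free_clique_free (H G : sgraph) :
  ~ minor H G -> clique_free (@adj G) #|H|.
Proof.
move=> noH C [C1 C2]; apply/eqP=> sC; apply: noH.
pose phi (x : H) := nth finset.set0 (enum C) (enum_rank x).
have lt (x : H) : (enum_rank x < size (enum C))%N by rewrite -cardE sC ltn_ord.
have phiC x : phi x \in C by rewrite -mem_enum mem_nth.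
have phi_neq x y : x != y -> phi x != phi y.
  rewrite nth_uniq ?enum_uniq //; apply: contra => /eqP/val_inj/enum_rank_inj ->.
  by [].
exists phi; split.
- by move=> x; apply/connected_inducedP; apply: C1.
- by move=> x y /phi_neq /(C2 _ _ (phiC x) (phiC y)) /andP[].
move=> x y xy; have xny : x != y by apply: contraTneq xy => ->; rewrite adj_irrefl.
by have /andP[_ /touchP] := C2 _ _ (phiC x) (phiC y) (phi_neq _ _ xny).
Qed.

(** [a] is the least integer with [n <= a ^ 3]; rounding up at most doubles a number that is at
    least 1. *)
Lemma cube_root_approx (R : realType) (n : nat) : (0 < n)%N ->
  exists2 a, (0 < a)%N & (n%:R : R) `^ 3^-1 <= a%:R <= 2 * (n%:R : R) `^ 3^-1.
Proof.
move=> n0; set y : R := _ `^ _.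
have y3 : y ^+ 3 = n%:R by rewrite -powR_mulrn ?powR_ge0 // -powRrM mulVf // powRr1.
have y1 : 1 <= y.
  by rewrite -(ler_pXn2r (n := 3)) ?nnegrE ?ler01 ?powR_ge0 // expr1n y3 ler1n.
have exa : exists a, (n <= a ^ 3)%N by exists n; rewrite -{1}(expn1 n) leq_pexp2l.
case: (ex_minnP exa) => a na amin.
have a0 : (0 < a)%N by rewrite lt0n; apply: contraTneq na => ->; rewrite exp0n // -ltnNge.
exists a => //; apply/andP; split.
  by rewrite -(ler_pXn2r (n := 3)) ?nnegrE ?powR_ge0 // y3 -natrX ler_nat.
have : (a.-1)%:R < y.
  rewrite -(ltr_pXn2r (n := 3)) ?nnegrE ?powR_ge0 // y3 -natrX ltr_nat ltnNge.
  by apply/negP=> /amin; rewrite leqNgt prednK // leqnn.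
have : a%:R = (a.-1)%:R + 1 :> R by rewrite natr1 prednK.
by lra.
Qed.

(** With [y] the cube root of [#|G|], the allowed size is a multiple of [y ^+ 2]. As
    [y <= a <= 2 * y], the separator needs the factor [6 * h ^ 2], and components of size [a ^ 2]
    need the factor 4. *)
Lemma clique_free_fragmentable (R : realType) (G : sgraph) (h : nat) :
  clique_free (@adj G) h ->
  fragmentable G ((6 * h ^ 2 + 4)%:R * #|G|%:R `^ (- 3^-1) : R).
Proof.
move=> hfree; have [G0|G0] := posnP #|G|.
  exists finset.set0; rewrite cards0 G0 mulr0; split=> // v.
  by have := card0_eq G0 (val v); rewrite !inE.
have [a a0 /andP[ya ay]] := cube_root_approx R G0.
set y : R := _ `^ _ in ya ay.
have y0 : 0 < y by rewrite powR_gt0 // ltr0n.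
have y3 : #|G|%:R = y ^+ 3 by rewrite -powR_mulrn ?powR_ge0 // -powRrM mulVf // powRr1.
have [S [hS Sc]] := clique_free_fragmentation (@adj_sym G) hfree a0.
rewrite /fragmentable (_ : _ * _ * #|G|%:R = (6 * h ^ 2 + 4)%:R * y ^+ 2); last first.
  by rewrite powRN -/y y3 -mulrA; congr (_ * _); field; rewrite gt_eqF.
exists S; split.
  have e1 : #|S|%:R * y <= (6 * h ^ 2)%:R * y ^+ 2 * y.
    rewrite -mulrA -exprSr -y3 -natrM; apply: le_trans (_ : (#|S| * a)%:R <= _).
      by rewrite natrM ler_wpM2l.
    by rewrite ler_nat.
  rewrite ler_pM2r // in e1; apply: le_trans e1 _.
  by apply: ler_wpM2r; rewrite ?exprn_ge0 ?(ltW y0) // ler_nat leq_addr.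
move=> v; have vS := valP v.
have e2 : (#|component v| <= a ^ 2)%N.
  apply: leq_trans (Sc _ (comp_in_conn (@adj_sym G) vS) (comp_in_sub _ _ _)).
  rewrite -(card_imset _ val_inj); apply: subset_leq_card; apply/fintype.subsetP=> u.
  move=> /imsetP[u' + ->]; rewrite !inE => /connect_induced ->.
  by rewrite andbT; have := valP u'; rewrite inE.
apply: le_trans (_ : 4 * y ^+ 2 <= _).
  apply: le_trans (_ : (a ^ 2)%:R <= _); first by rewrite ler_nat.
  by rewrite natrX (_ : 4 = 2 ^+ 2) -?exprMn ?ler_pXn2r ?nnegrE ?mulr_ge0 ?(ltW y0) //; ring.
by apply: ler_wpM2r; rewrite ?exprn_ge0 ?(ltW y0) // ler_nat leq_addl.
Qed.

Lemma scaled_Theta (R : realType) (g : nat -> R) (k : R) : 0 < k ->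
  (fun n => k * g n) =Theta_(\oo%classic) g.
Proof.
move=> k0; rewrite eqThetaE qualifE; apply/asboolP; exists (k, k) => /=; first by rewrite k0.
by apply: nearW => n; rewrite normrM gtr0_norm.
Qed.

Lemma minor_free_no_algorithm (R : realType) (H : sgraph) :
  exists eps : nat -> R,
    eps =Theta_(\oo%classic) (fun n => n%:R `^ (- 3^-1)) /\
    forall G : sgraph, ~ minor H G -> no_algorithm G (eps #|G|).
Proof.
exists (fun n => (6 * #|H| ^ 2 + 4)%:R * n%:R `^ (- 3^-1)); split.
  by apply: scaled_Theta; rewrite ltr0n addn_gt0 orbT.
move=> G /minor_free_clique_free hfree; apply: fragmentable_no_algorithm.
exact: clique_free_fragmentable hfree.
Qed.

Theorem theorem1p3 (R : realType) :
  (forall (G : sgraph) (eps : R), fragmentable G eps -> no_algorithm G eps) /\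
  (exists eps : nat -> R,
     eps =Theta_(\oo%classic) (fun n => n%:R `^ (- 3^-1)) /\
     forall G : sgraph, planar R G -> no_algorithm G (eps #|G|)) /\
  (forall H : sgraph, exists eps : nat -> R,
     eps =Theta_(\oo%classic) (fun n => n%:R `^ (- 3^-1)) /\
     forall G : sgraph, ~ minor H G -> no_algorithm G (eps #|G|)).
Proof.
split; first exact: fragmentable_no_algorithm.
split; last exact: minor_free_no_algorithm.
have [eps [epsT epsP]] := minor_free_no_algorithm R (complete 5).
by exists eps; split=> // G /planar_K5_minor_free /epsP.
Qed.
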